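(* Let $W(x)$ be a weight matrix. The algebra $\mathcal D(W)$ is affine, i.e. finitely generated as an algebra over $\mathbb C$.
   Context: Differential operators act on the right: $M_N(\Omega[x])$ is the algebra of matrix differential operators $\mathfrak D=\sum_j\partial_x^jA_j(x)$ with $A_j\in M_N(\mathbb C[x])$, acting on matrix functions by $F\cdot\mathfrak D=\sum_jF^{(j)}A_j$, with product determined by $F\cdot(\mathfrak D\mathfrak E)=(F\cdot\mathfrak D)\cdot\mathfrak E$. A weight matrix $W$ supported on an interval $(x_0,x_1)$ (possibly infinite) is a Hermitian matrix-valued function $W:\mathbb R\to M_N(\mathbb C)$, zero outside $(x_0,x_1)$, entrywise smooth and positive definite on $(x_0,x_1)$, with finite moments $\int x^mW(x)dx$ for all $m\ge0$. It defines $\langle P,Q\rangle_W=\int P(x)W(x)Q(x)^*dx$ for $P,Q\in M_N(\mathbb C[x])$. The sequence of monic orthogonal polynomials $P(x,n)$, $n\ge0$, of $W$ is the unique sequence in $M_N(\mathbb C[x])$ with $P(x,n)$ of degree $n$ and leading coefficient $I$, and $\langle P(x,n),P(x,m)\rangle_W=0$ for $m\ne n$. $\mathcal D(W)$ is the algebra of all $\mathfrak D\in M_N(\Omega[x])$ for which there are matrices $\Lambda(n)\in M_N(\mathbb C)$ with $P(x,n)\cdot\mathfrak D=\Lambda(n)P(x,n)$ for all $n\geq0$. *)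

(* Defs.v *)
From HB Require Import structures.
From mathcomp Require Import all_boot all_order all_algebra.
From mathcomp Require Import sesquilinear spectral complex.
From mathcomp Require Import all_classical all_reals all_analysis.

Set Implicit Arguments.
Unset Strict Implicit.
Unset Printing Implicit Defensive.

Import Order.TTheory GRing.Theory Num.Theory.
Import numFieldNormedType.Exports.

Local Open Scope ring_scope.

(* The size of the matrices is written n.+1 throughout, so that 'M[C]_n.+1 is  *)
(* a nonzero ring. M_{n+1}(C[x]) is represented as {poly 'M[C]_n.+1}, that is, *)
(* polynomials in a central variable with matrix coefficients.                 *)

(* The operator \sum_j \partial_x^j A_j(x) is represented by the polynomial    *)
(* \sum_j A_j 'X^j. This is an alias: the product below is composition of      *)
(* operators and not the product of {poly {poly 'M[C]_n.+1}}.                  *)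
Definition diffop (C : numFieldType) (n : nat) : Type :=
  {poly {poly 'M[C]_n.+1}}.

HB.instance Definition _ (C : numFieldType) (n : nat) :=
  GRing.Zmodule.on (diffop C n).

Section DiffopAlgebra.
Context {C : numFieldType} {n : nat}.
Local Notation Mx := {poly 'M[C]_n.+1}.
Local Notation PolyOp := {poly {poly 'M[C]_n.+1}}.
Implicit Types (F : Mx) (D E : diffop C n).

Definition opcoef D (j : nat) : Mx := (D : PolyOp)`_j.

Definition dact F D : Mx := \sum_(j < size (D : PolyOp)) F^`(j) * opcoef D j.

(* D \partial_x, from (\partial^j A) \partial = \partial^(j+1) A + \partial^j A' *)
Definition oppartial D : diffop C n :=
  ((D : PolyOp) * 'X + map_poly (@deriv _) (D : PolyOp) : PolyOp).

(* D (\sum_k \partial^k B_k) = \sum_k (D \partial^k) B_k; see dactM            *)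
Definition opmul D E : diffop C n :=
  (\sum_(k < size (E : PolyOp))
     (iter k oppartial D : PolyOp) * (opcoef E k)%:P : PolyOp).

Definition opone : diffop C n := (1 : PolyOp).

Definition opscale (c : C) D : diffop C n :=
  ((c%:M%:P : Mx) *: (D : PolyOp) : PolyOp).

Lemma dactE F D m : (size (D : PolyOp) <= m)%N ->
  dact F D = \sum_(j < m) F^`(j) * opcoef D j.
Proof.
move=> le_m; rewrite /dact (big_ord_widen m (fun j => F^`(j) * opcoef D j)) //.
rewrite big_mkcond; apply: eq_bigr => j _; case: ifPn => //.
by rewrite -leqNgt => h; rewrite /opcoef nth_default ?mulr0.
Qed.

Lemma dactD F D E : dact F (D + E) = dact F D + dact F E.
Proof.
pose m := maxn (size (D : PolyOp)) (size (E : PolyOp)).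
rewrite !(@dactE _ _ m) ?leq_maxl ?leq_maxr //; last exact: size_polyD.
by rewrite -big_split; apply: eq_bigr => j _; rewrite /opcoef coefD mulrDr.
Qed.

Lemma dact0 F : dact F 0 = 0.
Proof. by rewrite /dact size_poly0 big_ord0. Qed.

Lemma dactB F D E : dact F (D - E) = dact F D - dact F E.
Proof. by apply/eqP; rewrite eq_sym subr_eq -dactD subrK. Qed.

Lemma dactDl F G D : dact (F + G) D = dact F D + dact G D.
Proof.
by rewrite -big_split; apply: eq_bigr => j _; rewrite derivnD mulrDl.
Qed.

Lemma dact_mulC F (P : PolyOp) (B : Mx) :
  dact F (P * B%:P : PolyOp) = dact F P * B.
Proof.
have le_s : (size (P * B%:P)%R <= size P)%N.
  apply: leq_trans (size_polyMleq _ _) _; rewrite size_polyC.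
  by case: (B != 0); rewrite ?addn1 ?addn0 ?leq_pred.
rewrite (dactE _ le_s) mulr_suml; apply: eq_bigr => j _.
by rewrite /opcoef coefMC mulrA.
Qed.

Lemma dact_oppartial F D : dact F (oppartial D) = (dact F D)^`().
Proof.
pose m := size (D : PolyOp).
have s1 : (size ((D : PolyOp) * 'X)%R <= m.+1)%N.
  by rewrite (leq_trans (size_polyMleq _ _)) // size_polyX addn2.
have s2 : (size (map_poly (@deriv _) (D : PolyOp)) <= m)%N by exact: size_poly.
rewrite [LHS]dactD (dactE _ s1) (dactE _ s2) big_ord_recl /opcoef coefMX /=.
rewrite mulr0 add0r raddf_sum -big_split; apply: eq_bigr => j _ /=.
by rewrite derivM /opcoef coefMX coef_map_id0 ?deriv0 // lift0 derivnS.
Qed.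

Lemma dact_iter F D k : dact F (iter k oppartial D) = (dact F D)^`(k).
Proof. by elim: k => [//|k IHk]; rewrite iterS dact_oppartial IHk derivnS. Qed.

Lemma dactM F D E : dact F (opmul D E) = dact (dact F D) E.
Proof.
rewrite /opmul [RHS]/dact.
elim/big_ind2: _ => [|x1 x2 y1 y2 <- <-|k _]; first exact: dact0.
  exact: dactD.
by rewrite dact_mulC dact_iter.
Qed.

Lemma dact1 F : dact F opone = F.
Proof. by rewrite /dact size_poly1 big_ord1 /opcoef coef1 mulr1. Qed.

Lemma dactZ F c D : dact F (opscale c D) = c%:M%:P * dact F D.
Proof.
have le_s : (size (opscale c D : PolyOp) <= size (D : PolyOp))%N.
  exact: size_scale_leq.
rewrite (dactE _ le_s) mulr_sumr; apply: eq_bigr => j _.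
rewrite /opcoef coefZ !mulrA; congr (_ * _).
by apply/polyP => i; rewrite coefMC coefCM; apply: scalar_mxC.
Qed.

Lemma dactZl F c D : dact (c%:M%:P * F) D = c%:M%:P * dact F D.
Proof.
rewrite mulr_sumr; apply: eq_bigr => j _.
by rewrite !mul_polyC derivnZ scalerAl.
Qed.

Lemma dact_inj D E : (forall F, dact F D = dact F E) -> D = E.
Proof.
move=> eqDE; apply/eqP; rewrite -subr_eq0.
have {eqDE} : forall F, dact F (D - E) = 0 by move=> F; rewrite dactB eqDE subrr.
move: (D - E) => {D E} D D0; apply/eqP/polyP => j.
rewrite coef0; elim/ltn_ind: j => j IHj.
have le_m : (size (D : PolyOp) <= (maxn (size (D : PolyOp)) j.+1))%N.
  exact: leq_maxl.
have lt_j : (j < maxn (size (D : PolyOp)) j.+1)%N by exact: leq_maxr.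
have := D0 ('X^j); rewrite (dactE _ le_m) (bigD1 (Ordinal lt_j)) //= big1 => [|k].
  rewrite addr0 derivnXn subnn expr0 ffactnn mulr_natl => /polyP Dj.
  apply/polyP => i; apply/matrixP => a b.
  have /matrixP /(_ a b) := Dj i.
  rewrite coefMn coef0 mulmxnE !mxE => /eqP; rewrite mulrn_eq0.
  by rewrite -leqn0 leqNgt fact_gt0 => /eqP.
rewrite -val_eqE /= derivnXn; case: ltngtP => // [lt_kj|lt_jk] _.
  by rewrite /opcoef IHj ?mulr0.
by rewrite ffact_small // mulr0n mul0r.
Qed.

Lemma opmulA : associative opmul.
Proof. by move=> D E G; apply: dact_inj => F; rewrite !dactM. Qed.
Lemma opmul1 : left_id opone opmul.
Proof. by move=> D; apply: dact_inj => F; rewrite dactM dact1. Qed.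
Lemma opmulr1 : right_id opone opmul.
Proof. by move=> D; apply: dact_inj => F; rewrite dactM dact1. Qed.
Lemma opmulDl : left_distributive opmul +%R.
Proof.
by move=> D E G; apply: dact_inj => F; rewrite !(dactM, dactD) dactDl.
Qed.
Lemma opmulDr : right_distributive opmul +%R.
Proof. by move=> D E G; apply: dact_inj => F; rewrite !(dactM, dactD). Qed.
Lemma opone_neq0 : opone != 0.
Proof. exact: (oner_neq0 PolyOp). Qed.

HB.instance Definition _ := GRing.Zmodule_isNzRing.Build (diffop C n)
  opmulA opmul1 opmulr1 opmulDl opmulDr opone_neq0.

Lemma opscaleA a b D : opscale a (opscale b D) = opscale (a * b) D.
Proof. by rewrite /opscale scalerA -polyCM [in RHS]scalar_mxM. Qed.
Lemma opscale1 : left_id 1 opscale.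
Proof. by move=> D; rewrite /opscale scale1r. Qed.
Lemma opscaleDr : right_distributive opscale +%R.
Proof. by move=> c D E; rewrite /opscale scalerDr. Qed.
Lemma opscaleDl D : {morph opscale^~ D : a b / a + b}.
Proof. by move=> a b; rewrite /opscale raddfD polyCD scalerDl. Qed.

HB.instance Definition _ := GRing.Zmodule_isLmodule.Build C (diffop C n)
  opscaleA opscale1 opscaleDr opscaleDl.

Lemma opscaleAl (c : C) D E : c *: (D * E) = (c *: D) * E.
Proof. by apply: dact_inj => F; rewrite !(dactM, dactZ) dactZl. Qed.

HB.instance Definition _ :=
  GRing.Lmodule_isLalgebra.Build C (diffop C n) opscaleAl.

Lemma opscaleAr (c : C) D E : c *: (D * E) = D * (c *: E).
Proof. by apply: dact_inj => F; rewrite !(dactM, dactZ). Qed.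

HB.instance Definition _ :=
  GRing.Lalgebra_isAlgebra.Build C (diffop C n) opscaleAr.

End DiffopAlgebra.

Local Open Scope classical_set_scope.

(* Subalgebras are unital. The equation also forces B to be a subalgebra.       *)
Definition affine_subalgebra (K : fieldType) (A : algType K) (B : set A) :
    Prop :=
  exists s : seq A,
    B = smallest (fun S : set A => GRing.subalg_closed [in S]) [set` s].

Section Weight.
Context {R : realType} {n : nat}.
Local Notation C := R[i].
Local Notation mu := (@lebesgue_measure R).
Local Open Scope complex_scope.
Local Open Scope sesquilinear_scope.

Definition smooth_on (I : set R) (f : R -> R) : Prop :=
  forall k t, I t -> derivable (f^`(k)) t 1.

Definition csmooth_on (I : set R) (f : R -> C) : Prop :=
  smooth_on I (fun t => complex.Re (f t)) /\
  smooth_on I (fun t => complex.Im (f t)).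

Definition cintegrable (f : R -> C) : Prop :=
  mu.-integrable setT (fun t => (complex.Re (f t))%:E) /\
  mu.-integrable setT (fun t => (complex.Im (f t))%:E).

Definition cintegral (f : R -> C) : C :=
  Rintegral mu setT (fun t => complex.Re (f t)) +i*
  Rintegral mu setT (fun t => complex.Im (f t)).

Definition positive_definite (A : 'M[C]_n.+1) : Prop :=
  forall v : 'rV[C]_n.+1, v != 0 -> 0 < (v *m A *m v^t*) 0 0.

Definition open_itv (x0 x1 : \bar R) : set R :=
  [set t | (x0 < t%:E)%E && (t%:E < x1)%E].

Record weight_matrix (x0 x1 : \bar R) (W : R -> 'M[C]_n.+1) : Prop := {
  weight_itv : (x0 < x1)%E;
  weight_herm : forall t, W t \is hermsymmx;
  weight_supp : forall t, ~ open_itv x0 x1 t -> W t = 0;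
  weight_smooth : forall i j, csmooth_on (open_itv x0 x1) (fun t => W t i j);
  weight_posdef : forall t, open_itv x0 x1 t -> positive_definite (W t);
  weight_moments : forall (m : nat) i j,
    cintegrable (fun t => (t%:C) ^+ m * W t i j)
}.

Definition evalmx (P : {poly 'M[C]_n.+1}) (t : R) : 'M[C]_n.+1 :=
  P.[(t%:C)%:M].

Definition weight_inner (W : R -> 'M[C]_n.+1) (P Q : {poly 'M[C]_n.+1}) :
    'M[C]_n.+1 :=
  \matrix_(i, j)
    cintegral (fun t => (evalmx P t *m W t *m (evalmx Q t)^t*) i j).

Record monic_orthogonal (W : R -> 'M[C]_n.+1) (P : nat -> {poly 'M[C]_n.+1}) :
    Prop := {
  mop_size : forall k, size (P k) = k.+1;
  mop_monic : forall k, P k \is monic;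
  mop_orth : forall k m, m <> k -> weight_inner W (P k) (P m) = 0
}.

(* The sequence P is unique for a weight matrix, so that quantifying it        *)
(* existentially amounts to naming it.                                         *)
Definition DW (W : R -> 'M[C]_n.+1) : set (diffop C n) :=
  [set D | exists2 P : nat -> {poly 'M[C]_n.+1}, monic_orthogonal W P &
     exists L : nat -> 'M[C]_n.+1, forall k, dact (P k) D = L k *: P k].

End Weight.

(* Main.v *)
Require Import Defs.
From mathcomp Require Import all_boot all_order all_algebra.
From mathcomp Require Import complex.
From mathcomp Require Import all_classical all_reals all_analysis.
From mathcomp Require Import perm sesquilinear spectral zify ring lra.

Set Implicit Arguments.
Unset Strict Implicit.
Unset Printing Implicit Defensive.

Import Order.TTheory GRing.Theory Num.Theory.
Import numFieldNormedType.Exports.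

Local Open Scope ring_scope.
Local Open Scope sesquilinear_scope.

(** Why D(W) is finitely generated.

An operator D in D(W) acts on the monic orthogonal polynomials by
P_k . D = L_D(k) P_k.  The matrix L_D(k) is the coefficient of x^k in x^k . D,
so it is a polynomial in k ([horner_symbol_mx], [symbol_eigen]), and
D |-> L_D is an injective algebra homomorphism.

The algebra has a positive involution.  The operator of multiplication by x is
symmetric for the inner product of W.  A left linear endomorphism of M_N(C[x])
is a differential operator with polynomial coefficients exactly when some
iterated commutator with x kills it ([diffop_of_adX_nilpotent]), and passing to
the adjoint preserves this.  Hence the formal adjoint of D, which acts on P_k
by H_k L_D(k)^* H_k^-1 where H_k = <P_k, P_k>, is again a differential operator
([exists_adjoint]).  Write H_k = S_k S_k^* ([posdef_factor]).  Conjugation by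
S_k turns L_D into matrices ev_k(D) for which the involution is the conjugate
transpose, while tr (ev_k(D) ev_k(E)^* ) = tr (L_D(k) L_{E^dag}(k)) is still a
polynomial in k.

Filter the algebra by the degree of T_D(k) = tr (ev_k(D) ev_k(D)^* ), the square
of the Frobenius norm.  The inequalities for that norm say that the filtration
is multiplicative and that D D^dag has exactly twice the filtration degree of D.
More than N^2 matrices of size N are dependent for every k, so their Gram
determinant is zero, and the coefficient of top degree of that determinant
shows that each graded piece has dimension at most N^2 ([fil_gr_bound]).

It remains to see that such a filtered algebra is finitely generated
([filtered_star_algebra_fingen]).  Choose a maximal family of self-adjoint
elements z_i of one positive degree e whose mutual products vanish in the
associated graded algebra.  Such a family is independent in its graded piece,
so its size is bounded.  If z is the sum of the z_i and z y vanishes in the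
graded algebra for some y of positive degree d not zero there, then a power of
y y^dag could be added to suitable powers of the z_i, against maximality.  So
left multiplication by z is injective from the graded piece of degree d to
that of degree e + d for all d > 0.  The dimensions of these pieces are
bounded, so from some degree on this map is bijective, and the algebra is
generated by the finite dimensional space of its elements of lower degree. *)

(** * Bounded sequences of natural numbers *)

Lemma max_nat_bounded (P : nat -> Prop) (M : nat) :
  P 0%N -> (forall k, P k -> (k <= M)%N) ->
  exists2 k, P k & forall k', P k' -> (k' <= k)%N.
Proof.
move=> P0 PM.
have exP : exists k, `[< P k >] by exists 0%N; apply/asboolP.
have ubP k : `[< P k >] -> (k <= M)%N by move/asboolP; apply: PM.
case: (ex_maxnP exP ubP) => k /asboolP Pk maxk; exists k => // k' Pk'.
by apply: maxk; apply/asboolP.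
Qed.

Lemma nondecreasing_nat_stab (r : nat -> nat) (M : nat) :
  (forall d, r d <= r d.+1)%N -> (forall d, r d <= M)%N ->
  exists D, forall d, (D <= d)%N -> r d = r D.
Proof.
move=> r_nd rM.
have r_mono d e : (d <= e)%N -> (r d <= r e)%N.
  by move=> /subnK <-; elim: (e - d)%N => // k IHk; exact: leq_trans IHk (r_nd _).
have [||k [D le_kD] maxk] := @max_nat_bounded (fun k => exists D, (k <= r D)%N) M.
- by exists 0%N.
- by move=> k [D le_kD]; apply: leq_trans le_kD (rM D).
exists D => d /r_mono le_Dd; apply/eqP; rewrite eqn_leq le_Dd andbT.
by apply: leq_trans le_kD; apply: maxk; exists d.
Qed.

(** The sums of r over m consecutive integers form a bounded nondecreasing
    sequence, and the difference of two successive sums is r (m + d) - r d. *)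
Lemma nondecreasing_period_stab (r : nat -> nat) (M m : nat) :
  (forall d, r d <= r (m + d))%N -> (forall d, r d <= M)%N ->
  exists D, forall d, (D <= d)%N -> r (m + d)%N = r d.
Proof.
move=> r_nd rM; pose R d := (\sum_(i < m) r (i + d))%N.
have RS d : (R d + r (m + d) = r d + R d.+1)%N.
  rewrite /R -(big_ord_recr m (fun i => r (i + d)%N)) /= big_ord_recl /=.
  by congr addn; apply: eq_bigr => i _; rewrite /bump leq0n addnS.
have [d|d|D RD] := @nondecreasing_nat_stab R (m * M).
- by rewrite -(leq_add2l (r d)) -RS addnC leq_add2l.
- rewrite -[X in (X * M)%N]card_ord -sum_nat_const.
  exact: leq_sum.
exists D => d le_Dd; apply/eqP; rewrite -(eqn_add2l (R d)) RS addnC eqn_add2r.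
by rewrite (RD d) // (RD d.+1) // leqW.
Qed.

(** * Filtered algebras with a positive involution *)

Section FilteredStarAlgebra.
Variables (K : fieldType) (A : algType K).
Variables (F : nat -> A -> Prop) (dag : A -> A) (M : nat).

(** The space F d.+1 consists of the elements of degree at most d.  The shift
    leaves F 0 for the zero space, so that an element x of F d.+1 vanishes in
    the graded piece of degree d exactly when F d x, for every d. *)
Hypothesis F0_eq0 : forall x, F 0 x -> x = 0.
Hypothesis F_zero : forall d, F d 0.
Hypothesis FZD : forall d a x y, F d x -> F d y -> F d (a *: x + y).
Hypothesis FS : forall d x, F d x -> F d.+1 x.
Hypothesis FM : forall d e x y, F d.+1 x -> F e.+1 y -> F (d + e).+1 (x * y).
Hypothesis Fdag : forall d x, F d x -> F d (dag x).
Hypothesis dagK : forall d x, F d x -> dag (dag x) = x.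
Hypothesis dagM : forall d x y, F d x -> F d y -> dag (x * y) = dag y * dag x.
(** Positivity: x x^dag does not vanish in the graded algebra unless x does. *)
Hypothesis Fpos :
  forall d x, F d.+1 x -> F (d + d) (x * dag x) -> F d x.

Definition gr_free d k (x : 'I_k -> A) :=
  (forall i, F d.+1 (x i)) /\
  (forall c, F d (\sum_i c i *: x i) -> forall i, c i = 0).

Hypothesis gr_bound : forall d k (x : 'I_k -> A), gr_free d x -> (k <= M)%N.

Lemma FZ d a x : F d x -> F d (a *: x).
Proof. by move=> Fx; rewrite -[_ *: _]addr0; apply: FZD. Qed.

Lemma FD d x y : F d x -> F d y -> F d (x + y).
Proof. by move=> Fx Fy; rewrite -[x]scale1r; apply: FZD. Qed.

Lemma FB d x y : F d x -> F d y -> F d (x - y).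
Proof. by move=> Fx Fy; rewrite addrC -scaleN1r; apply: FZD. Qed.

Lemma Fsum d I (r : seq I) (P : pred I) (f : I -> A) :
  (forall i, P i -> F d (f i)) -> F d (\sum_(i <- r | P i) f i).
Proof. by move=> Ff; elim/big_ind: _ => // x y; apply: FD. Qed.

Lemma Fle d e x : (d <= e)%N -> F d x -> F e x.
Proof. by move=> /subnK <- Fx; elim: (e - d)%N => // k; apply: FS. Qed.

Lemma FMl d e x y : F d x -> F e.+1 y -> F (d + e) (x * y).
Proof. by case: d => [/F0_eq0 -> _|d]; [rewrite mul0r | apply: FM]. Qed.

Lemma FMr d e x y : F d.+1 x -> F e y -> F (d + e) (x * y).
Proof. by case: e => [_ /F0_eq0 ->|e]; [rewrite mulr0 | rewrite addnS; apply: FM]. Qed.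

Lemma FX d k x : F d.+1 x -> F (k.+1 * d).+1 (x ^+ k.+1).
Proof.
move=> Fx; elim: k => [|k IHk]; first by rewrite mul1n expr1.
by rewrite exprS mulSn; apply: FM.
Qed.

Lemma dag_mul d e x y : F d x -> F e y -> dag (x * y) = dag y * dag x.
Proof.
by move=> Fx Fy; apply: (@dagM (maxn d e)); [move: Fx|move: Fy];
  apply: Fle; rewrite ?leq_maxl ?leq_maxr.
Qed.

Lemma dagX d k x : F d.+1 x -> dag x = x -> dag (x ^+ k.+1) = x ^+ k.+1.
Proof.
move=> Fx xs; elim: k => [|k IHk]; first by rewrite expr1.
by rewrite exprS (dag_mul Fx (FX k Fx)) IHk xs -exprSr.
Qed.

(** By positivity the squares, hence all the powers of exponent 2 ^ j, of a
    self-adjoint element nonzero in the graded algebra are nonzero there, and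
    a vanishing power makes all higher powers vanish. *)
Lemma FX_selfadjoint d k x : F d.+1 x -> dag x = x ->
  F (k.+1 * d) (x ^+ k.+1) -> F d x.
Proof.
move=> Fx xs Fxk.
have ltk : (k.+1 < 2 ^ k.+1)%N by apply: ltn_expl.
have: F (2 ^ k.+1 * d) (x ^+ (2 ^ k.+1)).
  have [r ->] : exists r, (2 ^ k.+1 = k.+1 + r.+1)%N.
    by exists (2 ^ k.+1 - k.+2)%N; rewrite addnS -addSn subnKC.
  by rewrite exprD mulnDl; apply: FMl Fxk (FX r Fx).
elim: (k.+1) => [|j IHj]; first by rewrite expn0 mul1n expr1.
rewrite expnS mul2n -addnn mulnDl exprD => F2j; apply: IHj.
have /prednK e2 : (0 < 2 ^ j)%N by rewrite expn_gt0.
have := FX (2 ^ j).-1 Fx; have := dagX (2 ^ j).-1 Fx xs.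
by rewrite e2 => xjs /Fpos; apply; rewrite xjs.
Qed.

(** Elements whose product vanishes in the graded algebra keep this property
    when raised to powers, which is how families of elements of distinct
    degrees are brought to a common degree. *)
Lemma FMX_vanish d e m p x y : F d.+1 x -> F e.+1 y -> F (d + e) (x * y) ->
  F (m.+1 * d + p.+1 * e) (x ^+ m.+1 * y ^+ p.+1).
Proof.
move=> Fx Fy Fxy; elim: m => [|m IHm]; last first.
  by rewrite exprS -mulrA mulSn -addnA; apply: FMr.
elim: p => [|p IHp]; first by rewrite !expr1 !mul1n.
by rewrite [y ^+ _]exprSr mulrA [(p.+2 * e)%N]mulSnr addnA; apply: FMl.
Qed.

Definition orth_family D k (z : 'I_k -> A) :=
  [/\ forall i, F D.+1 (z i) /\ ~ F D (z i), forall i, dag (z i) = z i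
    & forall i j, i != j -> F (D + D) (z i * z j)].

(** Multiplying a relation between the members by one of them isolates the
    square of this member, which is nonzero in the graded algebra. *)
Lemma orth_family_free D k (z : 'I_k -> A) : orth_family D z -> gr_free D z.
Proof.
move=> [Fz zs zo]; split=> [i|c Fc j]; first by case: (Fz i).
apply: contrapT => /eqP cj0; case: (Fz j) => Fzj; apply.
apply: Fpos => //; rewrite zs.
have: F (D + D) ((\sum_i c i *: z i) * z j) by apply: FMl.
rewrite mulr_suml (bigD1 j) //= => Fs.
have: F (D + D) (\sum_(i < k | i != j) c i *: z i * z j).
  by apply: Fsum => i ij; rewrite -scalerAl; apply/FZ/zo.
move=> /(FB Fs); rewrite addrK -scalerAl => /(FZ (c j)^-1).
by rewrite scalerA mulVf // scale1r.
Qed.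

Lemma orth_family_power D k (z : 'I_k -> A) m :
  orth_family D z -> orth_family (m.+1 * D) (fun i => z i ^+ m.+1).
Proof.
move=> [Fz zs zo]; split=> [i|i|i j ij].
- have [Fzi nFzi] := Fz i; split; first exact: FX.
  by move/(FX_selfadjoint Fzi (zs i)).
- by case: (Fz i) => Fzi _; apply: dagX Fzi (zs i).
have [[Fzi _] [Fzj _]] := (Fz i, Fz j).
exact: FMX_vanish Fzi Fzj (zo _ _ ij).
Qed.

(** The element z is the sum of an orthogonal family of maximal size; any y that
    z kills in the graded algebra would yield a larger family. *)
Lemma exists_gr_regular : exists D z, [/\ (0 < D)%N, F D.+1 z &
  forall d y, (0 < d)%N -> F d.+1 y -> F (D + d) (z * y) -> F d y].
Proof.
have [||k [D [z [D0 zorth]]] maxk] := @max_nat_bounded (fun k =>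
  exists D, exists z : 'I_k -> A, (0 < D)%N /\ orth_family D z) M.
- by exists 1%N, (fun=> 0); split=> //; split; case.
- by move=> k [D [z [_ /orth_family_free/gr_bound]]].
have [Fz zs zo] := zorth.
exists D, (\sum_i z i); split=> //.
  by apply: Fsum => i _; case: (Fz i).
move=> d y d0 Fy Fzy; apply: contrapT => nFy.
pose w := y * dag y.
have Fw : F (d + d).+1 w by apply: FM (Fdag _).
have nFw : ~ F (d + d) w by move=> /(Fpos Fy).
have ws : dag w = w by rewrite (dag_mul Fy (Fdag Fy)) (dagK Fy).
(* A self-adjoint w that z kills is orthogonal to each z i: multiplying z w by
   z i leaves z i * z i * w, and w * z i then vanishes by positivity. *)
have Fzw : F (D + (d + d)) ((\sum_i z i) * w).
  by rewrite mulrA addnA; apply: FMl Fzy (Fdag Fy).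
have Fwz i : F (d + d + D) (w * z i).
  have [Fzi _] := Fz i.
  have Fzzw : F (D + (D + (d + d))) (z i * z i * w).
    have := FMr Fzi Fzw; rewrite mulrA mulr_sumr (bigD1 i) //= mulrDl => Fs.
    have: F (D + (D + (d + d))) ((\sum_(j < k | j != i) z i * z j) * w).
      rewrite addnA; apply: FMl Fw; apply: Fsum => j ji.
      by apply: zo; rewrite eq_sym.
    by move=> /(FB Fs); rewrite addrK.
  apply: Fpos; first exact: FM.
  have -> : (d + d + D + (d + d + D) = (d + d) + (D + (D + (d + d))))%N by lia.
  by rewrite (dag_mul Fw Fzi) zs ws -mulrA [z i * _]mulrA; apply: FMr.
have Fzw' i : F (D + (d + d)) (z i * w).
  have [Fzi _] := Fz i.
  by have := Fdag (Fwz i); rewrite (dag_mul Fw Fzi) zs ws addnC.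
(* The z i have degree D and w has degree d + d: pass to the common degree. *)
have [Zo Wo] : orth_family ((d + d) * D) (fun i => z i ^+ (d + d)) /\
    orth_family (D * (d + d)) (fun _ : 'I_1 => w ^+ D).
  split; [have/prednK <- : (0 < d + d)%N by rewrite addn_gt0 d0|].
    exact: orth_family_power.
  rewrite -(prednK D0); apply: (@orth_family_power _ _ (fun=> w)); split=> // i j.
  by rewrite !ord1 eqxx.
have: (k.+1 <= k)%N; last by rewrite ltnn.
apply: maxk; exists ((d + d) * D)%N.
exists (fun i => oapp (fun j => z j ^+ (d + d)) (w ^+ D) (unlift ord0 i)).
split; first by rewrite muln_gt0 addn_gt0 d0.
case: Zo Wo => ZF Zs Zz []; rewrite mulnC => WF Ws _.
split=> [i|i|i j].
- by case: (unlift ord0 i) => /= [?|]; [apply: ZF|apply: (WF ord0)].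
- by case: (unlift ord0 i) => /= [?|]; [apply: Zs|apply: (Ws ord0)].
have ddP : (d + d).-1.+1 = (d + d)%N by rewrite prednK // addn_gt0 d0.
case: (unliftP ord0 i) => [i' ->|->]; case: (unliftP ord0 j) => [j' ->|->] //=.
- by rewrite (inj_eq lift_inj); apply: Zz.
- move=> _; have [Fzi _] := Fz i'.
  have := FMX_vanish (d + d).-1 D.-1 Fzi Fw (Fzw' i').
  by rewrite ddP (prednK D0) [(D * (d + d))%N]mulnC.
- move=> _; have [Fzj _] := Fz j'.
  have := FMX_vanish D.-1 (d + d).-1 Fw Fzj (Fwz j').
  by rewrite ddP (prednK D0) [(D * (d + d))%N]mulnC.
Qed.

Lemma gr_free_mull D z d k (x : 'I_k -> A) : F D.+1 z ->
    (forall y, F d.+1 y -> F (D + d) (z * y) -> F d y) ->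
  gr_free d x -> gr_free (D + d) (fun i => z * x i).
Proof.
move=> Fz zreg [Fx xfree]; split=> [i|c Fc]; first exact: FM.
apply: xfree; apply: zreg; first by apply: Fsum => i _; apply: FZ.
by rewrite mulr_sumr; move: Fc; under eq_bigr do rewrite scalerAr.
Qed.

Lemma gr_free_max_span d k (x : 'I_k -> A) : gr_free d x ->
    (forall k' (x' : 'I_k' -> A), gr_free d x' -> (k' <= k)%N) ->
  forall y, F d.+1 y -> exists c, F d (y - \sum_i c i *: x i).
Proof.
move=> [Fx xfree] maxk y Fy; apply: contrapT => nspan.
have: (k.+1 <= k)%N; last by rewrite ltnn.
apply: (maxk _ (fun i => oapp x y (unlift ord0 i))); split=> [i|c].
  by case: (unlift ord0 i).
rewrite big_ord_recl unlift_none /=.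
under eq_bigr do rewrite liftK /=.
have [c0|c0] := eqVneq (c ord0) 0; last first.
  move=> /(FZ (c ord0)^-1); rewrite scalerDr scalerA mulVf // scale1r => Fc.
  case: nspan; exists (fun i => - ((c ord0)^-1 * c (lift ord0 i))).
  rewrite -sumrN; move: Fc; rewrite scaler_sumr.
  by under eq_bigr do rewrite scalerA -[_ *: _]opprK -scaleNr.
rewrite c0 scale0r add0r => /xfree cs i.
by case: (unliftP ord0 i) => [j ->|-> //]; apply: cs.
Qed.

Lemma exists_gr_basis : exists r : nat -> nat,
  (forall d, exists x : 'I_(r d) -> A, gr_free d x) /\
  (forall d k (x : 'I_k -> A), gr_free d x -> (k <= r d)%N).
Proof.
have /choice[r rP] : forall d, exists r, (exists x : 'I_r -> A, gr_free d x) /\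
    (forall k (x : 'I_k -> A), gr_free d x -> (k <= r)%N).
  move=> d; have [||r Pr maxr] := @max_nat_bounded (fun k =>
     exists x : 'I_k -> A, gr_free d x) M.
  - by exists (fun=> 0); split=> [[]//|c _ []].
  - by move=> k [x /gr_bound].
  by exists r; split=> // k x xfree; apply: maxr; exists x.
by exists r; split=> [d|d]; have [] := rP d.
Qed.

Lemma F_finite_span d : exists s : seq A, (forall x, x \in s -> F d x) /\
  forall S : A -> Prop, S 0 -> (forall a x y, S x -> S y -> S (a *: x + y)) ->
    (forall x, x \in s -> S x) -> forall x, F d x -> S x.
Proof.
elim: d => [|d [s [Fs spans]]].
  by exists [::]; split=> // S S0 _ _ x /F0_eq0 ->.
have [r [rfree rmax]] := exists_gr_basis; have [x xfree] := rfree d.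
exists (s ++ [seq x i | i <- enum 'I_(r d)]); split=> [y|S S0 SZD Sx y Fy].
  rewrite mem_cat => /orP[/Fs/FS //|/mapP[i _ ->]].
  by case: xfree.
have [c Fc] := gr_free_max_span xfree (rmax d) Fy.
rewrite -[y](subrK (\sum_i c i *: x i)) addrC.
have Sc : S (y - \sum_i c i *: x i).
  by apply: spans Fc => // t ts; apply: Sx; rewrite mem_cat ts.
move: (y - _) Sc => u Su.
elim/big_rec: _ => [|i t _ St]; first by rewrite add0r.
rewrite -addrA; apply: SZD St; apply: Sx; rewrite mem_cat map_f ?orbT //.
by rewrite mem_enum.
Qed.

(** Left multiplication by the regular element z maps the graded piece of degree
    e.+1 injectively into that of degree D + e.+1.  Beyond the degree where the
    dimensions stabilise, a basis of the source thus goes to a basis of the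
    target, and every element is z times one of lower degree, modulo elements
    of lower degree. *)
Theorem filtered_star_algebra_fingen : exists s : seq A,
  (forall x, x \in s -> exists d, F d x) /\
  forall S : A -> Prop, GRing.subalg_closed (fun x => `[< S x >]) ->
    (forall x, x \in s -> S x) -> forall d x, F d x -> S x.
Proof.
have [D [z [D0 Fz zreg]]] := exists_gr_regular.
have [r [rfree rmax]] := exists_gr_basis.
(* The shift by one excludes degree 0, where z may fail to be regular. *)
have [d|d|E rE] := @nondecreasing_period_stab (fun d => r d.+1) M D.
- have [x xfree] := rfree d.+1; rewrite -addnS.
  apply: rmax (gr_free_mull Fz _ xfree) => y; exact: zreg.
- by have [x /gr_bound] := rfree d.+1.
have [s [Fs spans]] := F_finite_span (D + E).+2.
exists s; split=> [x /Fs|S [S1 SZD SM] Ss d x]; first by exists (D + E).+2.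
have SZD' a u v : S u -> S v -> S (a *: u + v).
  by move=> Su Sv; apply/asboolP/SZD; apply/asboolP.
have S0 : S 0.
  have /asboolP S1' := S1; have := SZD' (-1) 1 1 S1' S1'.
  by rewrite scaleN1r addNr.
have {}spans := spans S S0 SZD' Ss.
elim: d x => [x /F0_eq0 -> //|d IHd x Fx].
have [le_d|lt_d] := leqP d (D + E).+1; first by apply: spans; apply: Fle Fx.
have Dd : (D <= d.-1)%N by lia.
pose e := (d.-1 - D)%N; have de : (D + e.+1 = d)%N by rewrite /e; lia.
have re : r (D + e.+1)%N = r e.+1 by rewrite addnS rE //; rewrite /e; lia.
have [t tfree] := rfree e.+1.
have ztfree : gr_free d (fun i => z * t i).
  by rewrite -de; apply: gr_free_mull tfree => // y; apply: zreg.
have [|c Fc] := gr_free_max_span ztfree _ Fx.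
  by rewrite -re de; apply: rmax.
rewrite -[x](subrK (\sum_i c i *: (z * t i))) addrC.
move: (x - _) (IHd _ Fc) => v Sv.
elim/big_rec: _ => [|i u _ Su]; first by rewrite add0r.
rewrite -addrA; apply: SZD' Su; apply/asboolP/SM; apply/asboolP.
  by apply: spans; apply: Fle Fz; lia.
by case: tfree => /(_ i) Ft _; apply: IHd; apply: Fle Ft; lia.
Qed.
End FilteredStarAlgebra.

(** * The Frobenius norm *)

Section Frobenius.
Variable C : numClosedFieldType.

Lemma cauchy_schwarz_mx n (u v : 'rV[C]_n) :
  `|(u *m v^t*) 0 0| ^+ 2 <= (u *m u^t*) 0 0 * (v *m v^t*) 0 0.
Proof. by rewrite -!dotmxE; apply: (CauchySchwarz (@dotmx C n)). Qed.

(** The square of the Frobenius norm, which keeps all inequalities polynomial. *)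
Definition frob n (X : 'M[C]_n) : C := \tr (X *m X^t*).

Lemma frobE n (X : 'M[C]_n) : frob X = \sum_i \sum_j `|X i j| ^+ 2.
Proof.
apply: eq_bigr => i _; rewrite mxE; apply: eq_bigr => j _.
by rewrite !mxE normCK.
Qed.

Lemma dotmx_sum n (u v : 'rV[C]_n) : (u *m v^t*) 0 0 = \sum_j u 0 j * (v 0 j)^*.
Proof. by rewrite mxE; apply: eq_bigr => j _; rewrite !mxE. Qed.

Lemma trace_mxvec n (X Y : 'M[C]_n) :
  \tr (X *m Y^t*) = (mxvec X *m (mxvec Y)^t*) 0 0.
Proof.
rewrite dotmx_sum (reindex (uncurry (@mxvec_index n n))) /=; last first.
  exact: curry_mxvec_bij.
transitivity (\sum_(p : 'I_n * 'I_n) X p.1 p.2 * (Y p.1 p.2)^*).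
  rewrite -(pair_bigA _ (fun i j => X i j * (Y i j)^*)) /=.
  by apply: eq_bigr => i _; rewrite mxE; apply: eq_bigr => j _; rewrite !mxE.
by apply: eq_bigr => -[i j] _; rewrite /= !mxvecE.
Qed.

Lemma frob_ge0 n (X : 'M[C]_n) : 0 <= frob X.
Proof.
by rewrite frobE; do 2![apply: sumr_ge0 => ? _]; rewrite exprn_ge0.
Qed.

Lemma frob_eq0 n (X : 'M[C]_n) : frob X = 0 -> X = 0.
Proof.
rewrite frobE => X0; apply/matrixP => i j; rewrite mxE.
have ge0 i' : true -> 0 <= \sum_j `|X i' j| ^+ 2.
  by move=> _; apply: sumr_ge0 => ? _; rewrite exprn_ge0.
have /psumr_eq0P Xi := psumr_eq0P ge0 X0 (erefl true : xpredT i).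
apply/eqP; rewrite -normr_eq0 -sqrf_eq0.
by rewrite Xi // => ? _; rewrite exprn_ge0.
Qed.

Lemma trace_cauchy_schwarz n (X Y : 'M[C]_n) :
  `|\tr (X *m Y^t*)| ^+ 2 <= frob X * frob Y.
Proof. by rewrite /frob !trace_mxvec cauchy_schwarz_mx. Qed.

Lemma frob_adj n (X : 'M[C]_n) : frob (X^t*) = frob X.
Proof. by rewrite /frob trmxCK mxtrace_mulC. Qed.

Lemma frobZ n (a : C) (X : 'M[C]_n) : frob (a *: X) = `|a| ^+ 2 * frob X.
Proof.
rewrite !frobE mulr_sumr; apply: eq_bigr => i _; rewrite mulr_sumr.
by apply: eq_bigr => j _; rewrite mxE normrM exprMn.
Qed.

Lemma frobD n (X Y : 'M[C]_n) : frob (X + Y) <= 2 * frob X + 2 * frob Y.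
Proof.
rewrite !frobE !mulr_sumr -big_split; apply: ler_sum => i _ /=.
rewrite !mulr_sumr -big_split; apply: ler_sum => j _ /=.
rewrite mxE; have := exprn_ge0 2 (normr_ge0 (X i j - Y i j)).
rewrite !normCK !rmorphD !rmorphN /=; set x := X i j; set y := Y i j.
rewrite -subr_ge0 => h; rewrite -subr_ge0; move: h; rewrite !subr0.
by congr (is_true (0 <= _)); ring.
Qed.

(** Cauchy-Schwarz for the rows of X and the columns of Y, entry by entry. *)
Lemma frobM n (X Y : 'M[C]_n) : frob (X *m Y) <= frob X * frob Y.
Proof.
rewrite frobE -[frob Y]frob_adj 2!frobE.
rewrite mulr_suml; apply: ler_sum => i _.
rewrite mulr_sumr; apply: ler_sum => j _.
have := cauchy_schwarz_mx (row i X) (row j (Y^t*)).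
rewrite !dotmx_sum.
have -> : \sum_k (row i X) 0 k * ((row j (Y^t*)) 0 k)^* = (X *m Y) i j.
  by rewrite mxE; apply: eq_bigr => k _; rewrite !mxE conjCK.
by congr (_ <= _ * _); apply: eq_bigr => k _; rewrite mxE normCK.
Qed.

(** Cauchy-Schwarz for X X^* and the identity matrix. *)
Lemma frob_sqr_le n (X : 'M[C]_n) : frob X ^+ 2 <= n%:R * frob (X *m X^t*).
Proof.
have := trace_cauchy_schwarz (X *m X^t*) 1%:M.
rewrite [frob 1%:M]/frob trmx1 map_mx1 !mulmx1 mxtrace1 mulrC.
by rewrite -[\tr _]/(frob X) ger0_norm ?frob_ge0.
Qed.

End Frobenius.

(** * Degrees of polynomials and their values at the natural numbers *)

Section PolyGrowth.
Variable C : numClosedFieldType.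
Hypothesis archC : forall x : C, exists n : nat, `|x| < n%:R.

(** If p had degree d and q lower degree, the leading term of p at m would be
    bounded by a multiple of m ^ (d - 1). *)
Lemma size_le_of_horner_le (p q : {poly C}) :
  (forall n : nat, `|p.[n%:R]| <= `|q.[n%:R]|) -> (size p <= size q)%N.
Proof.
move=> le_pq; rewrite leqNgt; apply/negP => lt_qp.
have [d sp] : exists d, size p = d.+1 by case: (size p) lt_qp => // d _; exists d.
have nz_a : p`_d != 0.
  have := lead_coef_eq0 p; rewrite lead_coefE sp /= => ->.
  by rewrite -size_poly_eq0 sp.
have sq : (size q <= d)%N by rewrite -ltnS -sp.
pose K := \sum_(i < d) (`|q`_i| + `|p`_i|).
have [m ltm] := archC (K / `|p`_d|).
have K0 : 0 <= K / `|p`_d|.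
  by rewrite divr_ge0 // sumr_ge0 // => i _; rewrite addr_ge0.
suff: m.+1%:R <= K / `|p`_d|.
  rewrite -(ger0_norm K0) => /le_lt_trans/(_ ltm).
  by rewrite ltr_nat ltnNge leqnSn.
rewrite ler_pdivlMr ?normr_gt0 //.
have x0 : 0 < m.+1%:R ^+ d :> C by rewrite exprn_gt0 // ltr0n.
rewrite -(ler_pM2r x0) mulrAC -exprS.
have lead_le : `|p`_d| * m.+1%:R ^+ d <=
    \sum_(i < d) (`|q`_i| + `|p`_i|) * m.+1%:R ^+ i.
  have -> : `|p`_d| * m.+1%:R ^+ d =
      `|p.[m.+1%:R] - \sum_(i < d) p`_i * m.+1%:R ^+ i|.
    rewrite (horner_coef_wide _ (eq_leq sp)) big_ord_recr /= addrAC subrr add0r.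
    by rewrite normrM normrX normr_nat.
  apply: (le_trans (ler_normB _ _)).
  under [X in _ <= X]eq_bigr do rewrite mulrDl.
  rewrite big_split /=; apply: lerD.
    apply: (le_trans (le_pq _)); rewrite (horner_coef_wide _ sq).
    apply: (le_trans (ler_norm_sum _ _ _)); apply: ler_sum => i _.
    by rewrite normrM normrX normr_nat.
  apply: (le_trans (ler_norm_sum _ _ _)); apply: ler_sum => i _.
  by rewrite normrM normrX normr_nat.
rewrite exprS mulrAC -mulrA; apply: (le_trans (ler_wpM2l (ler0n _ _) lead_le)).
rewrite mulr_sumr /K mulr_suml; apply: ler_sum => i _.
rewrite mulrCA -exprS ler_wpM2l ?addr_ge0 // ler_weXn2l ?ler1n //.
Qed.

Lemma poly_eq_nat (p q : {poly C}) :
  (forall n : nat, p.[n%:R] = q.[n%:R]) -> p = q.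
Proof.
move=> eq_pq; apply/eqP; rewrite -subr_eq0 -size_poly_leq0 -(size_poly0 C).
apply: size_le_of_horner_le => n.
by rewrite hornerD hornerN eq_pq subrr horner0.
Qed.

End PolyGrowth.

Lemma coef_prod_top (R : comNzRingType) (I : Type) (r : seq I)
    (p : I -> {poly R}) d :
  (forall i, (size (p i) <= d.+1)%N) ->
  (\prod_(i <- r) p i)`_(size r * d) = \prod_(i <- r) (p i)`_d.
Proof.
move=> sp.
suff [] : (size (\prod_(i <- r) p i)%R <= (size r * d).+1)%N /\
  (\prod_(i <- r) p i)`_(size r * d) = \prod_(i <- r) (p i)`_d by [].
elim: r => [|i r [IHs IHc]].
  by rewrite !big_nil size_poly1 coef1.
rewrite !big_cons /= mulSn; split.
  apply: (leq_trans (size_polyMleq _ _)).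
  have := leq_add (sp i) IHs; rewrite addnS addSn.
  by case: (_ + _)%N.
rewrite coefM.
have lt_d : (d < (d + size r * d).+1)%N by rewrite ltnS leq_addr.
rewrite (bigD1 (Ordinal lt_d)) //= addKn IHc [X in _ + X]big1 ?addr0 // => j.
rewrite -val_eqE /= neq_ltn => /orP[ltj|ltj]; last first.
  by rewrite (nth_default 0 (leq_trans (sp i) ltj)) mul0r.
rewrite [X in _ * X]nth_default ?mulr0 //; apply: leq_trans IHs _.
by rewrite ltn_subRL addnC -ltn_subRL addnK.
Qed.

(** Every term of the Leibniz formula is a product of k polynomials of degree at
    most d, whose coefficient of degree k * d is the product of theirs. *)
Lemma coef_det_top (R : comNzRingType) k d (G : 'M[{poly R}]_k) :
  (forall i j, (size (G i j) <= d.+1)%N) ->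
  (\det G)`_(k * d) = \det (map_mx (fun p : {poly R} => p`_d) G).
Proof.
move=> sG; rewrite /determinant coef_sum; apply: eq_bigr => s _.
have e : (\prod_i G i (s i))`_(k * d) = \prod_i (G i (s i))`_d.
  have := @coef_prod_top R _ (enum 'I_k) (fun i => G i (s i)) d (fun i => sG _ _).
  by rewrite size_enum_ord !big_enum.
rewrite !mulr_sign; under [in RHS]eq_bigr do rewrite mxE.
by case: (odd_perm s); rewrite ?coefN e.
Qed.

(** * Star-algebras of sequences of matrices *)

Section StarAlgebraOfMatrixSequences.
Variables (C : numClosedFieldType) (N : nat) (A : algType C).
Variables (B : A -> Prop) (ev : nat -> A -> 'M[C]_N) (dag : A -> A).
Variable gram : A -> A -> {poly C}.
Hypothesis archC : forall x : C, exists n : nat, `|x| < n%:R.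
Hypothesis B_zero : B 0.
Hypothesis BZD : forall a x y, B x -> B y -> B (a *: x + y).
Hypothesis BM : forall x y, B x -> B y -> B (x * y).
Hypothesis Bdag : forall x, B x -> B (dag x).
Hypothesis evZD : forall n a x y, B x -> B y ->
  ev n (a *: x + y) = a *: ev n x + ev n y.
Hypothesis evM : forall n x y, B x -> B y -> ev n (x * y) = ev n x *m ev n y.
Hypothesis ev_inj : forall x, B x -> (forall n, ev n x = 0) -> x = 0.
Hypothesis ev_dag : forall n x, B x -> ev n (dag x) = (ev n x)^t*.
(** The matrices ev n x may depend on n in any way, as long as their pairwise
    traces are polynomials in n. *)
Hypothesis gramE : forall n x y, B x -> B y ->
  (gram x y).[n%:R] = \tr (ev n x *m (ev n y)^t*).

Definition fil d x := B x /\ (size (gram x x) <= d)%N.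

Lemma gram_frob n x : B x -> (gram x x).[n%:R] = frob (ev n x).
Proof. by move=> Bx; rewrite gramE. Qed.

Lemma ev_eq x y : B x -> B y -> (forall n, ev n x = ev n y) -> x = y.
Proof.
move=> Bx By exy; apply/eqP; rewrite -subr_eq0 addrC -scaleN1r; apply/eqP.
apply: ev_inj; first exact: BZD.
by move=> n; rewrite evZD // exy scaleN1r addNr.
Qed.

Lemma size_gram_le x q : B x -> (forall n, frob (ev n x) <= `|q.[n%:R]|) ->
  (size (gram x x) <= size q)%N.
Proof.
move=> Bx le_xq; apply: (size_le_of_horner_le archC) => n.
by rewrite gram_frob // ger0_norm ?frob_ge0.
Qed.

Lemma fil0_eq0 x : fil 0 x -> x = 0.
Proof.
case=> Bx /size_poly_leq0P g0; apply: ev_inj => // n; apply: frob_eq0.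
by rewrite -gram_frob // g0 horner0.
Qed.

Lemma fil_zero d : fil d 0.
Proof.
split=> //; suff -> : gram 0 0 = 0 by rewrite size_poly0.
apply: (poly_eq_nat archC) => n; rewrite gram_frob // horner0.
have ev0 : ev n 0 = 0.
  have -> : (0 : A) = (-1) *: 0 + 0 by rewrite scaler0 addr0.
  by rewrite evZD // scaleN1r addNr.
by rewrite ev0 /frob mul0mx mxtrace0.
Qed.

Lemma filZD d a x y : fil d x -> fil d y -> fil d (a *: x + y).
Proof.
move=> [Bx sx] [By sy]; split; first exact: BZD.
pose q := (2 * `|a| ^+ 2) *: gram x x + 2 *: gram y y.
have: (size q <= d)%N.
  apply: leq_trans (size_polyD _ _) _; rewrite geq_max.
  by rewrite !(leq_trans (size_scale_leq _ _)).
apply: leq_trans; apply: size_gram_le; first exact: BZD.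
move=> n; rewrite evZD // hornerD !hornerZ !gram_frob //.
apply: (le_trans (frobD _ _)); rewrite frobZ mulrA.
by rewrite [`|_ + _|]ger0_norm ?lexx // addr_ge0 // !mulr_ge0 ?frob_ge0 // exprn_ge0.
Qed.

Lemma filS d x : fil d x -> fil d.+1 x.
Proof. by move=> [Bx /leqW]. Qed.

Lemma filM d e x y : fil d.+1 x -> fil e.+1 y -> fil (d + e).+1 (x * y).
Proof.
move=> [Bx sx] [By sy]; split; first exact: BM.
apply: (@leq_trans (size (gram x x * gram y y)%R)).
  apply: size_gram_le => [|n]; first exact: BM.
  rewrite evM // hornerM !gram_frob // ger0_norm ?frobM //.
  by rewrite mulr_ge0 ?frob_ge0.
apply: (leq_trans (size_polyMleq _ _)).
by have := leq_add sx sy; rewrite addSn addnS; case: (_ + _)%N.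
Qed.

Lemma fil_dag d x : fil d x -> fil d (dag x).
Proof.
move=> [Bx sx]; split; first exact: Bdag.
apply: leq_trans sx; apply: size_gram_le => [|n]; first exact: Bdag.
by rewrite ev_dag // frob_adj gram_frob // ger0_norm ?frob_ge0.
Qed.

Lemma fil_dagK d x : fil d x -> dag (dag x) = x.
Proof.
move=> [Bx _]; apply: ev_eq => // [|n]; first by do 2!apply: Bdag.
by rewrite !ev_dag ?trmxCK //; apply: Bdag.
Qed.

Lemma fil_dagM d x y : fil d x -> fil d y -> dag (x * y) = dag y * dag x.
Proof.
move=> [Bx _] [By _].
have [[Bdx Bdy] Bxy] := (Bdag Bx, Bdag By, BM Bx By).
apply: ev_eq; [by apply: Bdag|by apply: BM|move=> n].
by rewrite ev_dag // !evM // !ev_dag // trmx_mul map_mxM.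
Qed.

Lemma size_sqr_poly (p : {poly C}) :
  (size p + size p <= (size (p * p)%R).+1)%N.
Proof.
have [->|nz] := eqVneq p 0; first by rewrite size_poly0.
by rewrite size_mul //; case: (_ + _)%N.
Qed.

(** By [frob_sqr_le] the square of gram x x is bounded by N times the gram
    polynomial of x * dag x. *)
Lemma fil_pos d x : fil d.+1 x -> fil (d + d) (x * dag x) -> fil d x.
Proof.
move=> [Bx sx] [Bxx sxx]; split => //.
have: (size (gram x x * gram x x)%R <= d + d)%N.
  have: (size (N%:R *: gram (x * dag x) (x * dag x)) <= d + d)%N.
    exact: leq_trans (size_scale_leq _ _) sxx.
  apply: leq_trans; apply: (size_le_of_horner_le archC) => n.
  rewrite hornerM hornerZ !gram_frob // evM // ?ev_dag //; last exact: Bdag.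
  rewrite -expr2 !ger0_norm ?frob_sqr_le ?exprn_ge0 ?frob_ge0 //.
  by rewrite mulr_ge0 ?frob_ge0.
have := size_sqr_poly (gram x x); lia.
Qed.

Lemma size_gram d x y : fil d.+1 x -> fil d.+1 y -> (size (gram x y) <= d.+1)%N.
Proof.
move=> [Bx sx] [By sy].
have: (size (gram x y * gram x y)%R <= (d + d).+1)%N.
  have: (size (gram x x * gram y y)%R <= (d + d).+1)%N.
    apply: (leq_trans (size_polyMleq _ _)).
    by have := leq_add sx sy; rewrite addSn addnS; case: (_ + _)%N.
  apply: leq_trans; apply: (size_le_of_horner_le archC) => n.
  rewrite !hornerM !gram_frob // normrM -expr2 gramE //.
  by rewrite [`|_ * _|]ger0_norm ?trace_cauchy_schwarz ?mulr_ge0 ?frob_ge0.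
have := size_sqr_poly (gram x y); lia.
Qed.

Lemma B_sum (I : Type) (r : seq I) (c : I -> C) (x : I -> A) :
  (forall i, B (x i)) -> B (\sum_(i <- r) c i *: x i).
Proof. by move=> Bx; elim/big_rec: _ => // i y _; apply: BZD. Qed.

Lemma ev_sum n (I : Type) (r : seq I) (c : I -> C) (x : I -> A) :
  (forall i, B (x i)) ->
  ev n (\sum_(i <- r) c i *: x i) = \sum_(i <- r) c i *: ev n (x i).
Proof.
move=> Bx; elim: r => [|i r IHr].
  rewrite !big_nil; have -> : (0 : A) = (-1) *: 0 + 0 by rewrite scaler0 addr0.
  by rewrite evZD // scaleN1r addNr.
by rewrite !big_cons evZD ?IHr //; apply: B_sum.
Qed.

(** At each n the Gram matrix is V V^* where V has only N * N columns. *)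
Lemma det_gram_eq0 k (x : 'I_k -> A) : (forall i, B (x i)) -> (N * N < k)%N ->
  \det (\matrix_(i, j) gram (x i) (x j)) = 0.
Proof.
move=> Bx lt_k; apply: (poly_eq_nat archC) => n.
rewrite horner0 -[_.[_]]/(horner_eval n%:R _) -det_map_mx.
pose V : 'M[C]_(k, N * N) := \matrix_i mxvec (ev n (x i)).
have -> : map_mx (horner_eval n%:R) (\matrix_(i, j) gram (x i) (x j)) = V *m V^t*.
  apply/matrixP => i j; rewrite !mxE /horner_eval gramE // trace_mxvec dotmx_sum.
  by apply: eq_bigr => l _; rewrite !mxE.
apply/eqP; rewrite -[_ == 0]negbK -unitfE -unitmxE -row_free_unit.
rewrite -row_leq_rank -ltnNge.
apply: leq_ltn_trans lt_k; apply: leq_trans (mulmx_max_rank V (V^t*)) _.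
exact: leqnn.
Qed.

(** The matrix of the coefficients of degree d of a Gram matrix of elements of
    degree d is singular.  A vector v in its left kernel gives the combination
    with coefficients v a gram polynomial without term of degree d. *)
Lemma fil_gr_bound d k (x : 'I_k -> A) : gr_free fil d x -> (k <= N * N)%N.
Proof.
move=> [Fx xfree]; rewrite leqNgt; apply/negP => lt_k.
have Bx i : B (x i) by case: (Fx i).
have := det_gram_eq0 Bx lt_k; set G := \matrix_(_, _) _ => detG.
have sG i j : (size (G i j) <= d.+1)%N by rewrite mxE; apply: size_gram.
have /esym/eqP := coef_det_top sG; rewrite detG coef0 => /det0P[v nz_v vG].
have {}vG i : \sum_j v 0 j * (gram (x j) (x i))`_d = 0.
  move/matrixP/(_ 0 i): vG; rewrite !mxE => vGi; rewrite -[RHS]vGi.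
  by apply: eq_bigr => j _; rewrite !mxE.
case/eqP: nz_v; apply/rowP => i; rewrite mxE.
apply: (xfree (v 0)); split; first exact: B_sum.
set y := \sum_i _.
have By : B y by apply: B_sum.
have -> : gram y y = \sum_j (v 0 j)^* *: \sum_i v 0 i *: gram (x i) (x j).
  apply: (poly_eq_nat archC) => n; rewrite gramE // /y ev_sum //.
  rewrite raddf_sum /= map_mx_sum mulmx_sumr raddf_sum horner_sum.
  apply: eq_bigr => j _; rewrite linearZ /= map_mxZ -scalemxAr mxtraceZ.
  rewrite hornerZ horner_sum mulmx_suml raddf_sum; congr (_ * _).
  by apply: eq_bigr => l _; rewrite hornerZ gramE // -scalemxAl /= mxtraceZ.
apply/leq_sizeP => l; rewrite leq_eqVlt => /orP[/eqP <-|lt_dl].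
  rewrite coef_sum big1 // => j _; rewrite coefZ coef_sum.
  by under eq_bigr do rewrite coefZ; rewrite vG mulr0.
rewrite coef_sum big1 // => j _; rewrite coefZ coef_sum big1 ?mulr0 // => m _.
by rewrite coefZ nth_default ?mulr0 //; apply: leq_trans lt_dl; apply: size_gram.
Qed.

Theorem star_algebra_fingen : exists s : seq A,
  (forall x, x \in s -> B x) /\
  forall S : A -> Prop, GRing.subalg_closed (fun x => `[< S x >]) ->
    (forall x, x \in s -> S x) -> forall x, B x -> S x.
Proof.
have [s [Fs genS]] := filtered_star_algebra_fingen fil0_eq0 fil_zero filZD filS filM
  fil_dag fil_dagK fil_dagM fil_pos fil_gr_bound.
exists s; split=> [x /Fs[d []] //|S Salg Ss x Bx].
by apply: (genS S Salg Ss (size (gram x x))).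
Qed.
End StarAlgebraOfMatrixSequences.

(** * Differential operators and commutators with x *)

Section DiffopReconstruct.
Variables (C : numFieldType) (n : nat).
Local Notation Mx := ('M[C]_n.+1).
Local Notation PolyOp := {poly {poly Mx}}.
Implicit Types (F G : {poly Mx}) (D E : diffop C n).

(** The derivative with respect to the symbol of d/dx is the commutator of D
    with multiplication by x. *)
Definition opderiv D : diffop C n := ((D : PolyOp)^`() : PolyOp).

Lemma dact_mulX F D : dact (F * 'X) D = dact F D * 'X + dact F (opderiv D).
Proof.
have [s le_s] : exists s, (size (D : PolyOp) <= s.+1)%N.
  by exists (size (D : PolyOp)).
have le_ds : (size (opderiv D : PolyOp) <= s)%N.
  have [->|nzD] := eqVneq (D : PolyOp) 0.
    by rewrite /opderiv deriv0 size_poly0.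
  by rewrite -ltnS; apply: leq_trans le_s; apply: lt_size_deriv.
rewrite !(dactE _ le_s) (dactE _ le_ds) mulr_suml !big_ord_recl /= -addrA.
congr (_ + _); first by rewrite -!mulrA (commr_polyX (opcoef D 0)).
rewrite -big_split; apply: eq_bigr => i _ /=.
have := derivnMXaddC i F 0; rewrite polyC0 addr0 => dFX.
rewrite !add0n -!derivnS dFX /bump leq0n add1n mulrDl addrC -!mulrA.
rewrite (commr_polyX (opcoef D i.+1)).
congr (_ + _).
by rewrite /opcoef coef_deriv mulrnAl mulrnAr.
Qed.

Lemma dactZM (c : Mx) F D : dact (c *: F) D = c *: dact F D.
Proof.
rewrite /dact scaler_sumr; apply: eq_bigr => j _.
by rewrite derivnZ scalerAl.
Qed.

Definition adX (psi : {poly Mx} -> {poly Mx}) F := psi F * 'X - psi (F * 'X).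

(** An antiderivative for [opderiv]; the index i.-1 at i = 0 is harmless because
    the factor i%:R^-1 is then zero. *)
Definition opint D : diffop C n :=
  (\poly_(i < (size (D : PolyOp)).+1)
     ((i%:R^-1)%:M%:P * opcoef D i.-1) : PolyOp).

Lemma opderiv_int D : opderiv (opint D) = D.
Proof.
apply/polyP => i; rewrite coef_deriv coef_poly ltnS.
case: ltnP => [_|le_s]; last by rewrite mul0rn nth_default.
have inv1 : ((i.+1%:R^-1)%:M%:P *+ i.+1 : {poly Mx}) = 1.
  rewrite -polyCMn -(raddfMn (@scalar_mx C n.+1)) /= -[_ *+ _]mulr_natr.
  by rewrite mulVf ?pnatr_eq0.
by rewrite /= -mulrnAl inv1 mul1r.
Qed.
Definition left_linear (psi : {poly Mx} -> {poly Mx}) :=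
  forall (c : Mx) F G, psi (c *: F + G) = c *: psi F + psi G.

Lemma left_linear0 psi : left_linear psi -> psi 0 = 0.
Proof.
move=> lin; have := lin (-1) 0 0.
by rewrite scaler0 addr0 scaleN1r addNr.
Qed.

Lemma dact_left_linear D : left_linear (fun F => dact F D).
Proof. by move=> c F G; rewrite dactDl dactZM. Qed.

Lemma adX_left_linear psi : left_linear psi -> left_linear (adX psi).
Proof.
move=> lin c F G; rewrite /adX lin [(c *: F + G) * 'X]mulrDl -scalerAl lin.
by rewrite mulrDl -scalerAl scalerBr opprD addrACA.
Qed.

Lemma left_linear_mulX psi : left_linear psi ->
  (forall F, psi (F * 'X) = psi F * 'X) -> forall F, psi F = F * psi 1.
Proof.
move=> lin psiX; elim/poly_ind => [|F c IHF].
  by rewrite left_linear0 // mul0r.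
rewrite addrC -[c%:P]mulr1 mul_polyC lin psiX IHF mulrDl -scalerAl mul1r.
by rewrite -!mulrA (commr_polyX (psi 1)).
Qed.

(** By induction adX psi is the action of some E.  Subtracting from psi the
    action of an antiderivative of -E leaves a left linear map that commutes
    with multiplication by x, which is right multiplication by its value at 1. *)
Theorem diffop_of_adX_nilpotent m psi : left_linear psi ->
  (forall F, iter m adX psi F = 0) -> exists D, forall F, psi F = dact F D.
Proof.
elim: m psi => [|m IHm] psi lin psi0.
  by exists 0 => F; rewrite dact0 -[RHS](psi0 F).
have [|F|E psiE] := IHm (adX psi); first exact: adX_left_linear.
  by rewrite -iterSr; apply: psi0.
pose E' := opint (- E); pose theta F := psi F - dact F E'.
have theta_lin : left_linear theta.
  move=> c F G; rewrite /theta lin dact_left_linear scalerBr opprD.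
  by rewrite addrACA.
have thetaX F : theta (F * 'X) = theta F * 'X.
  rewrite /theta dact_mulX opderiv_int mulrBl opprD addrA addrAC.
  congr (_ - _); rewrite -[- E]sub0r dactB dact0 sub0r opprK -psiE /adX.
  by rewrite addrC subrK.
exists (E' + ((1 : PolyOp) * (theta 1)%:P : PolyOp)) => F.
rewrite dactD dact_mulC -[1 : PolyOp]/(opone : PolyOp) dact1.
by rewrite -(left_linear_mulX theta_lin thetaX) /theta addrC subrK.
Qed.

End DiffopReconstruct.

(** * Factorization of positive definite matrices *)

Section PosdefFactor.
Variables (C : numClosedFieldType) (n : nat).

Lemma posdef_factor (A : 'M[C]_n) : A = A^t* ->
    (forall v : 'rV[C]_n, v != 0 -> 0 < (v *m A *m v^t*) 0 0) ->
  exists2 S : 'M[C]_n, S \in unitmx & A = S *m S^t*.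
Proof.
move=> Ah Apos.
have Aunit : A \in unitmx.
  rewrite unitmxE unitfE; apply/det0P => -[v nz_v vF].
  by have := Apos v nz_v; rewrite vF mul0mx mxE ltxx.
have Anormal : A \is normalmx by apply/normalmxP; rewrite -Ah.
set U := spectralmx A; set d := spectral_diag A.
have UU : U \is unitarymx := spectral_unitarymx A.
have AE : A = U^t* *m diag_mx d *m U.
  by rewrite -invmx_unitary //; apply/orthomx_spectralP.
have UAU : U *m A *m U^t* = diag_mx d.
  rewrite AE !mulmxA (unitarymxP UU) mul1mx -mulmxA (unitarymxP UU).
  by rewrite mulmx1.
have d_gt0 i : 0 < d 0 i.
  have : row i U != 0.
    apply/eqP => Ui; have := unitarymx_unit UU.
    rewrite -row_free_unit => /row_freeP[V VU].
    have := congr1 (row i) VU; rewrite row_mul Ui mul0mx => /rowP/(_ i)/eqP.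
    by rewrite !mxE eqxx eq_sym oner_eq0.
  move/Apos; rewrite -row_mul.
  suff -> : (row i (U *m A) *m (row i U)^t*) 0 0 = (U *m A *m U^t*) i i.
    by rewrite UAU mxE eqxx.
  by rewrite !mxE; apply: eq_bigr => k _; rewrite !mxE.
pose s := diag_mx (map_mx sqrtC d).
have ss : s *m s^t* = diag_mx d.
  rewrite /s tr_diag_mx map_diag_mx mulmx_diag; congr diag_mx.
  apply/rowP => i; rewrite !mxE -normCK -normrX sqrtCK.
  by rewrite ger0_norm // ltW.
have AS : A = (U^t* *m s) *m (U^t* *m s)^t*.
  rewrite trmx_mul map_mxM trmxCK mulmxA -[U^t* *m s *m _]mulmxA ss.
  exact: AE.
exists (U^t* *m s) => //.
by have := Aunit; rewrite {1}AS unitmx_mul => /andP[].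
Qed.

End PosdefFactor.

(** * The eigenvalue as a polynomial in the degree *)

Section Symbol.
Variables (C : numFieldType) (n : nat).
Local Notation Mx := ('M[C]_n.+1).
Local Notation PolyOp := {poly {poly Mx}}.
Implicit Types (F G : {poly Mx}) (D E : diffop C n).

Definition fall_poly j : {poly C} := \prod_(i < j) ('X - i%:R%:P).

Lemma horner_fall_poly j k : (fall_poly j).[k%:R] = (k ^_ j)%:R.
Proof.
elim: j => [|j IHj]; first by rewrite /fall_poly big_ord0 hornerE ffactn0.
rewrite /fall_poly big_ord_recr /= hornerM IHj hornerXsubC ffactnSr natrM.
have [lejk|ltkj] := leqP j k; first by rewrite natrB.
by rewrite ffact_small // !mul0r.
Qed.

(** When D is an eigenoperator of monic polynomials P_k of degree k, this is its
    eigenvalue at P_k; see [symbol_eigen]. *)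
Definition symbol D (k : nat) : Mx := (dact 'X^k D)`_k.

Definition symbol_mx D : 'M[{poly C}]_n.+1 :=
  \matrix_(a, b) \sum_(j < size (D : PolyOp)) (opcoef D j)`_j a b *: fall_poly j.

Lemma symbolE D k :
  symbol D k = \sum_(j < size (D : PolyOp)) (opcoef D j)`_j *+ (k ^_ j).
Proof.
rewrite /symbol /dact coef_sum; apply: eq_bigr => j _.
rewrite derivnXn mulrnAl coefMn coefXnM.
have [lejk|ltkj] := leqP j k; last by rewrite ffact_small // !mulr0n.
by rewrite subKn // ltnNge leq_subr.
Qed.

Lemma horner_symbol_mx D k :
  map_mx (horner_eval k%:R) (symbol_mx D) = symbol D k.
Proof.
apply/matrixP => a b; rewrite symbolE summxE !mxE /horner_eval horner_sum.
apply: eq_bigr => j _; rewrite hornerZ horner_fall_poly mulmxnE.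
by rewrite mulr_natr.
Qed.

End Symbol.

(** * Matrix orthogonal polynomials and their eigenoperators *)

Section OrthogonalPolynomials.
Variables (C : numClosedFieldType) (n : nat).
Local Notation Mx := ('M[C]_n.+1).
Local Notation PolyOp := {poly {poly Mx}}.
Implicit Types (F G : {poly Mx}) (D E : diffop C n).
Variable ip : {poly Mx} -> {poly Mx} -> Mx.
Hypothesis ipZD : forall (c : Mx) F G K, ip (c *: F + G) K = c *m ip F K + ip G K.
Hypothesis ip_herm : forall F G, ip G F = (ip F G)^t*.
Hypothesis ip_gt0 : forall F (v : 'rV[C]_n.+1), F \is monic -> v != 0 ->
  0 < (v *m ip F F *m v^t*) 0 0.

Lemma ip0l G : ip 0 G = 0.
Proof.
have := ipZD (-1) 0 0 G; rewrite scaler0 addr0 => ->.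
by rewrite mulNmx mul1mx addNr.
Qed.

Lemma ip0r G : ip G 0 = 0.
Proof. by rewrite ip_herm ip0l trmx0 map_mx0. Qed.

Lemma ipZl (c : Mx) F K : ip (c *: F) K = c *m ip F K.
Proof. by rewrite -[c *: F]addr0 ipZD ip0l addr0. Qed.

Lemma ipBl F G K : ip (F - G) K = ip F K - ip G K.
Proof. by rewrite addrC -scaleN1r ipZD mulNmx mul1mx addrC. Qed.

Lemma ipZDr (c : Mx) F G K : ip K (c *: F + G) = ip K F *m c^t* + ip K G.
Proof.
by rewrite ip_herm ipZD linearD /= map_mxD trmx_mul map_mxM -!ip_herm.
Qed.

Lemma ipBr F G K : ip K (F - G) = ip K F - ip K G.
Proof. by rewrite ip_herm ipBl linearB /= map_mxB -!ip_herm. Qed.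

Lemma ip_unit F : F \is monic -> ip F F \in unitmx.
Proof.
move=> F1; rewrite unitmxE unitfE; apply/det0P => -[v nz_v vF].
by have := ip_gt0 F1 nz_v; rewrite vF mul0mx mxE ltxx.
Qed.

Lemma monic_span_ind (P : nat -> {poly Mx}) (Q : {poly Mx} -> Prop) k :
    (forall j, (j < k)%N -> P j \is monic /\ size (P j) = j.+1) ->
    Q 0 -> (forall j (c : Mx) G, (j < k)%N -> Q G -> Q (c *: P j + G)) ->
  forall F, (size F <= k)%N -> Q F.
Proof.
elim: k => [|k IHk] Pm Q0 QD F sF.
  by move: sF => /size_poly_leq0P ->.
have [Pk1 sPk] := Pm k (leqnn _).
rewrite -[F](subrK (F`_k *: P k)) addrC; apply: (QD) => //.
apply: IHk => // [j ltj|j c G ltj|]; [exact/Pm/leqW|exact/QD/leqW|].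
apply/leq_sizeP => j; rewrite leq_eqVlt coefB coefZ => /orP[/eqP <-|ltj].
  by move/monicP: Pk1; rewrite lead_coefE sPk /= => ->; rewrite mulr1 subrr.
have -> : F`_j = 0 by apply: nth_default; apply: leq_trans sF ltj.
have -> : (P k)`_j = 0 by apply: nth_default; rewrite sPk.
by rewrite mulr0 subrr.
Qed.

(** The members of index at least k are unconstrained, so that the orthogonal
    polynomials can be built one at a time. *)
Definition orth_seq k (P : nat -> {poly Mx}) :=
  (forall j, (j < k)%N -> P j \is monic /\ size (P j) = j.+1) /\
  (forall i j, (i < k)%N -> (j < k)%N -> i <> j -> ip (P i) (P j) = 0).

(** The Gram-Schmidt process applied to 'X^k. *)
Lemma exists_orth_seq k : exists P, orth_seq k P.
Proof.
elim: k => [|k [P [Pm Po]]]; first by exists (fun=> 0).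
pose c j := ip 'X^k (P j) *m invmx (ip (P j) (P j)).
pose S := \sum_(j < k) c j *: P j.
have sS : (size S <= k)%N.
  apply: (leq_trans (size_sum _ _ _)); apply/bigmax_leqP => j _.
  by apply: leq_trans (size_scale_leq _ _) _; have [_ ->] := Pm _ (ltn_ord j).
pose Pk := 'X^k - S.
have sPk : size Pk = k.+1.
  by rewrite /Pk size_polyDl size_polyXn // size_polyN ltnS.
have Pk1 : Pk \is monic.
  rewrite monicE /lead_coef sPk coefB coefXn eqxx /= nth_default ?subr0 //.
have Pko j : (j < k)%N -> ip Pk (P j) = 0.
  move=> ltj; have [Pj1 _] := Pm _ ltj.
  have -> : ip Pk (P j) = ip 'X^k (P j) - \sum_(i < k) c i *m ip (P i) (P j).
    rewrite ipBl; congr (_ - _); rewrite /S.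
    elim/big_rec2: _ => [|i A1 B1 _ <-]; first by rewrite ip0l.
    by rewrite ipZD.
  rewrite (bigD1 (Ordinal ltj)) //= big1 ?addr0 => [|i].
    by rewrite mulmxKV ?subrr // ip_unit.
  rewrite -val_eqE /= => /eqP ij; rewrite Po ?mulmx0 //.
exists (fun j => if j == k then Pk else P j); split=> [j|i j].
  by rewrite ltnS leq_eqVlt; case: eqP => [-> _|_ /= /Pm].
rewrite !ltnS [(i <= k)%N]leq_eqVlt [(j <= k)%N]leq_eqVlt.
case: eqP => [->|_] /=; case: eqP => [->|_] //= lti ltj.
- by move=> _; apply: Pko.
- by move=> _; rewrite ip_herm Pko // trmx0 map_mx0.
exact: Po.
Qed.

Definition mop (P : nat -> {poly Mx}) :=
  [/\ forall k, size (P k) = k.+1, forall k, P k \is monic &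
      forall k m, m <> k -> ip (P k) (P m) = 0].

Lemma orth_seq_lower k P G : orth_seq k.+1 P -> (size G <= k)%N -> ip (P k) G = 0.
Proof.
move=> [Pm Po]; apply: (monic_span_ind (Q := fun G => ip (P k) G = 0)).
- by move=> j ltj; apply: Pm; apply: leqW.
- exact: ip0r.
move=> j c {}G ltj IHG; rewrite ipZDr IHG addr0 Po ?mul0mx //; first exact: leqW.
by move=> kj; rewrite kj ltnn in ltj.
Qed.

Lemma exists_mop : exists P, mop P.
Proof.
have /choice[P PP] : forall k, exists p : {poly Mx}, [/\ size p = k.+1, p \is monic &
    forall G, (size G <= k)%N -> ip p G = 0].
  move=> k; have [P Pk] := exists_orth_seq k.+1.
  exists (P k); case: (Pk) => Pm _; have [Pk1 sPk] := Pm k (leqnn _).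
  by split=> // G; apply: orth_seq_lower.
exists P; split=> [k|k|k m nkm]; try by case: (PP k).
have [sk _ ok] := PP k; have [sm _ om] := PP m.
have [ltmk|] := ltnP m k; first by apply: ok; rewrite sm.
rewrite leq_eqVlt => /orP[/eqP km|ltkm]; first by rewrite km in nkm.
by rewrite ip_herm [ip (P m) _]om ?trmx0 ?map_mx0 // sk.
Qed.

Section FixedMop.
Variable P : nat -> {poly Mx}.
Hypothesis mopP : mop P.
Let sP k : size (P k) = k.+1. Proof. by case: mopP. Qed.
Let mP k : P k \is monic. Proof. by case: mopP. Qed.
Let oP k m : m <> k -> ip (P k) (P m) = 0.
Proof. by case: mopP => _ _; apply. Qed.

Lemma mop_lowerr k G : (size G <= k)%N -> ip (P k) G = 0.
Proof.
apply: orth_seq_lower; split=> [j _|i j _ _ ij]; first by [].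
by apply: oP => ji; apply: ij.
Qed.

Lemma mop_lowerl k G : (size G <= k)%N -> ip G (P k) = 0.
Proof. by move=> sG; rewrite ip_herm mop_lowerr // trmx0 map_mx0. Qed.

Lemma mop_span_ind (Q : {poly Mx} -> Prop) : Q 0 ->
  (forall j (c : Mx) G, Q G -> Q (c *: P j + G)) -> forall F, Q F.
Proof.
move=> Q0 QD F; apply: (@monic_span_ind P Q (size F)) => // j c G _.
exact: QD.
Qed.

Lemma ip_eq0 G : (forall k, ip G (P k) = 0) -> G = 0.
Proof.
move=> G0; apply/eqP; rewrite -size_poly_eq0; apply/eqP.
suff: forall k, (size G <= k)%N -> size G = 0%N by apply.
elim=> [|k IHk]; first by case: (size G).
rewrite leq_eqVlt ltnS => /orP[/eqP sG|//].
have sD : (size (G - G`_k *: P k)%R <= k)%N.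
  apply/leq_sizeP => j; rewrite leq_eqVlt coefB coefZ => /orP[/eqP <-|ltj].
    by have /monicP := mP k; rewrite lead_coefE sP /= => ->; rewrite mulr1 subrr.
  have -> : G`_j = 0 by apply: nth_default; rewrite sG.
  have -> : (P k)`_j = 0 by apply: nth_default; rewrite sP.
  by rewrite mulr0 subrr.
have := mop_lowerl sD; rewrite ipBl G0 sub0r ipZl => /eqP; rewrite oppr_eq0.
move=> /eqP/(congr1 (mulmx^~ (invmx (ip (P k) (P k))))).
rewrite mulmxK ?ip_unit // mul0mx => Gk.
by apply: IHk; move: sD; rewrite Gk scale0r subr0.
Qed.

(** The difference of two monic candidates of degree k has lower degree, so it is
    orthogonal to all P j with k <= j, and to the others because both
    candidates are. *)
Lemma mop_uniq P' : mop P' -> P' = P.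
Proof.
move=> mopP'; have [sP' mP' oP'] := mopP'.
apply/funext => k; apply/eqP; rewrite -subr_eq0; apply/eqP/ip_eq0 => j.
have sD : (size (P' k - P k)%R <= k)%N.
  apply/leq_sizeP => i; rewrite leq_eqVlt coefB => /orP[/eqP <-|lti].
    have /monicP := mP k; have /monicP := mP' k.
    by rewrite !lead_coefE sP sP' /= => -> ->; rewrite subrr.
  by rewrite !nth_default ?sP ?sP' ?subrr.
have [lejk|ltjk] := leqP k j; first by apply: mop_lowerl; apply: leq_trans lejk.
rewrite ipBl [ip (P k) _]mop_lowerr ?sP // subr0.
apply: (@orth_seq_lower k P'); last by rewrite sP.
split=> [i _|i i' _ _ ii']; first by [].
by apply: oP' => e; apply: ii'.
Qed.

Hypothesis ip_mulX : forall F G, ip (F * 'X) G = ip F (G * 'X).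
Hypothesis archC : forall x : C, exists n : nat, `|x| < n%:R.
Let H k := ip (P k) (P k).

Definition transposed (D : diffop C n) (psi : {poly Mx} -> {poly Mx}) :=
  forall F G, ip (dact F D) G = ip F (psi G).

(** Multiplication by x is symmetric, so commutators with x are transposed into
    commutators with x. *)
Lemma transposed_deriv D psi :
  transposed D psi -> transposed (opderiv D) (adX psi).
Proof.
move=> Dpsi F G.
have -> : dact F (opderiv D) = dact (F * 'X) D - dact F D * 'X.
  by rewrite dact_mulX addrC addrA addNr add0r.
by rewrite ipBl Dpsi !ip_mulX Dpsi -ipBr.
Qed.

Lemma transposed_eq0 psi : transposed 0 psi -> forall F, psi F = 0.
Proof.
move=> psi0 G; apply: ip_eq0 => k.
by rewrite ip_herm -psi0 dact0 ip0l trmx0 map_mx0.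
Qed.

(** A high derivative of D is zero, so the corresponding iterated commutator of
    psi is transposed to 0 and vanishes. *)
Lemma transposed_diffop D psi : left_linear psi -> transposed D psi ->
  exists E, forall F, psi F = dact F E.
Proof.
move=> lin Dpsi; apply: (@diffop_of_adX_nilpotent C n (size (D : PolyOp)) psi lin).
apply: transposed_eq0.
have -> : (0 : diffop C n) = iter (size (D : PolyOp)) (@opderiv C n) D.
  by apply/esym/(@derivn_poly0 _ (D : PolyOp)).
elim: (size _) => [//|m IHm]; rewrite !iterS; exact: transposed_deriv.
Qed.

Definition eigen D L := forall k, dact (P k) D = L k *: P k.
(** The eigenvalues of the adjoint for the inner products H k. *)
Definition adj_eigenvalue (L : nat -> Mx) k := H k *m (L k)^t* *m invmx (H k).

Lemma H_herm k : (H k)^t* = H k.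
Proof. by rewrite /H -ip_herm. Qed.

(** The map psi is the formal adjoint of D: it expands F along the P j, the
    coefficient of P j being ip F (P j) * invmx (H j), and multiplies each term
    by the adjoint eigenvalue. *)
Lemma exists_adjoint D L : eigen D L -> exists E, eigen E (adj_eigenvalue L).
Proof.
move=> DL.
pose psi F := \sum_(j < size F) (ip F (P j) *m (L j)^t* *m invmx (H j)) *: P j.
have psiE F m : (size F <= m)%N ->
    psi F = \sum_(j < m) (ip F (P j) *m (L j)^t* *m invmx (H j)) *: P j.
  move=> le_m; rewrite /psi (big_ord_widen m
    (fun j => (ip F (P j) *m (L j)^t* *m invmx (H j)) *: P j)) //.
  rewrite big_mkcond; apply: eq_bigr => j _; case: ifPn => //.
  rewrite -leqNgt => h.
  by rewrite (mop_lowerl h) !mul0mx scale0r.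
have psi_lin : left_linear psi.
  move=> c F G; pose m := maxn (size F) (size G).
  have sZ : (size (c *: F) <= m)%N.
    by rewrite (leq_trans (size_scale_leq _ _)) // leq_maxl.
  rewrite !(psiE _ m) ?leq_maxl ?leq_maxr //; last first.
    by rewrite (leq_trans (size_polyD _ _)) // geq_max sZ leq_maxr.
  rewrite scaler_sumr -big_split; apply: eq_bigr => j _ /=.
  by rewrite ipZD !mulmxDl scalerDl scalerA -!mulmxA.
have psiP k : psi (P k) = adj_eigenvalue L k *: P k.
  rewrite /psi sP big_ord_recr /= big1 ?add0r // => j _.
  rewrite oP ?mul0mx ?scale0r // => jk.
  by have := ltn_ord j; rewrite jk ltnn.
have psiT : transposed D psi.
  move=> F G; apply: (mop_span_ind (Q := fun F => ip (dact F D) G = ip F (psi G))).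
    by rewrite (left_linear0 (dact_left_linear D)) !ip0l.
  move=> a c {}F IHF; rewrite dact_left_linear !ipZD IHF; congr (_ *m _ + _).
  rewrite DL ipZl; clear IHF.
  apply: (mop_span_ind (Q := fun G => L a *m ip (P a) G = ip (P a) (psi G))).
    by rewrite (left_linear0 psi_lin) !ip0r mulmx0.
  move=> b d {}G IHG; rewrite psi_lin !ipZDr -IHG mulmxDr; congr (_ + _).
  rewrite mulmxA; congr (_ *m _); rewrite psiP.
  rewrite -[adj_eigenvalue L b *: P b]addr0 ipZDr ip0r addr0.
  have [->|/eqP ba] := eqVneq b a; last by rewrite oP // mulmx0 mul0mx.
  have Hinv : (invmx (H a))^t* = invmx (H a) by rewrite trmx_inv map_invmx H_herm.
  rewrite -/(H a) /adj_eigenvalue !trmx_mul !map_mxM Hinv trmxCK H_herm.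
  by rewrite mulKVmx // ip_unit.
have [E psiE'] := transposed_diffop psi_lin psiT.
by exists E => k; rewrite -psiE' psiP.
Qed.

Lemma eigen_size D L F m : eigen D L -> (size F <= m)%N -> (size (dact F D) <= m)%N.
Proof.
move=> DL; apply: (monic_span_ind (P := P) (Q := fun F => (size (dact F D) <= m)%N)).
- by move=> j _; rewrite sP.
- by rewrite (left_linear0 (dact_left_linear D)) size_poly0.
move=> j c G ltj IHG; rewrite dact_left_linear DL.
rewrite (leq_trans (size_polyD _ _)) // geq_max IHG andbT.
by rewrite !(leq_trans (size_scale_leq _ _)) // sP.
Qed.

(** The polynomials 'X^k and P k differ by a polynomial of lower degree, and D does
    not raise degrees. *)
Lemma symbol_eigen D L : eigen D L -> forall k, L k = symbol D k.
Proof.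
move=> DL k; rewrite /symbol -['X^k](subrK (P k)) addrC.
rewrite dactDl DL coefD coefZ.
have := monicP (mP k); rewrite lead_coefE sP /= => ->; rewrite mulr1.
rewrite [X in _ + X]nth_default ?addr0 //; apply: (eigen_size DL).
apply/leq_sizeP => j; rewrite leq_eqVlt coefB coefXn => /orP[/eqP <-|ltj].
  by have := monicP (mP k); rewrite lead_coefE sP /= eqxx => ->; rewrite subrr.
by rewrite [(P k)`_j]nth_default ?sP // gtn_eqF // subr0.
Qed.

Definition eigenoperator D := exists L, eigen D L.

Lemma eigenoperatorP D : eigenoperator D -> eigen D (symbol D).
Proof.
by move=> [L DL] k; rewrite -(symbol_eigen DL).
Qed.

Lemma eigenoperator0 : eigenoperator 0.
Proof. by exists (fun=> 0) => k; rewrite dact0 scale0r. Qed.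

Lemma eigenoperator1 : eigenoperator 1.
Proof.
by exists (fun=> 1) => k; rewrite -[1 : diffop C n]/opone dact1 scale1r.
Qed.

Lemma eigenZD a D E K L : eigen D K -> eigen E L ->
  eigen (a *: D + E) (fun k => a *: K k + L k).
Proof.
move=> DK EL k; rewrite dactD -[a *: D]/(opscale a D) dactZ DK EL.
by rewrite mul_polyC scalerA scalerDl -[a%:M * _]/(a%:M *m _) mul_scalar_mx.
Qed.

Lemma eigenM D E K L : eigen D K -> eigen E L ->
  eigen (D * E) (fun k => K k *m L k).
Proof.
move=> DK EL k; rewrite -[D * E]/(opmul D E) dactM DK dactZM EL.
by rewrite scalerA.
Qed.

(** Conjugating the eigenvalues by S k, where H k = S k (S k)^*, turns the adjoint
    into the conjugate transpose and leaves the traces of products unchanged. *)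
Theorem eigenoperator_fingen : exists s : seq (diffop C n),
  (forall D, D \in s -> eigenoperator D) /\
  forall S : diffop C n -> Prop, GRing.subalg_closed (fun x => `[< S x >]) ->
    (forall D, D \in s -> S D) -> forall D, eigenoperator D -> S D.
Proof.
have /choice[S SP] : forall k, exists S : Mx, S \in unitmx /\ H k = S *m S^t*.
  move=> k; have [||S Su HS] := @posdef_factor C n.+1 (H k).
  - by rewrite H_herm.
  - by move=> v nz_v; apply: ip_gt0.
  by exists S.
have /choice[dag dagP] : forall D, exists E, eigenoperator D ->
    eigen E (adj_eigenvalue (symbol D)).
  move=> D; case: (pselect (eigenoperator D)) => [DD|nDD]; last by exists D.
  by have [E EP] := exists_adjoint (eigenoperatorP DD); exists E.
pose ev k D := invmx (S k) *m symbol D k *m S k.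
pose gram D E := \tr (symbol_mx D *m symbol_mx (dag E)).
have symdag D k : eigenoperator D -> symbol (dag D) k = adj_eigenvalue (symbol D) k.
  by move=> /dagP/symbol_eigen ->.
have ev_dag k D : eigenoperator D -> ev k (dag D) = (ev k D)^t*.
  move=> DD; rewrite /ev symdag // /adj_eigenvalue; have [Su HS] := SP k.
  have Stu : (S k)^t* \in unitmx by rewrite map_unitmx unitmx_tr.
  have HiS : invmx (H k) *m S k = (invmx (S k))^t*.
    rewrite trmx_inv map_invmx -[X in _ *m X](mulmxK Stu) -HS.
    by rewrite mulKmx // ip_unit.
  rewrite !trmx_mul !map_mxM -HiS -!mulmxA {1}HS -mulmxA.
  by rewrite mulKmx.
have evZD k a D E : eigenoperator D -> eigenoperator E ->
    ev k (a *: D + E) = a *: ev k D + ev k E.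
  move=> /eigenoperatorP DD /eigenoperatorP EE.
  rewrite /ev -(symbol_eigen (eigenZD a DD EE)) mulmxDr mulmxDl.
  by rewrite -scalemxAr -scalemxAl.
have evM k D E : eigenoperator D -> eigenoperator E -> ev k (D * E) = ev k D *m ev k E.
  move=> /eigenoperatorP DD /eigenoperatorP EE; have [Su _] := SP k.
  by rewrite /ev -(symbol_eigen (eigenM DD EE)) !mulmxA mulmxK.
have ev_inj D : eigenoperator D -> (forall k, ev k D = 0) -> D = 0.
  move=> /eigenoperatorP DD ev0; apply: dact_inj => F; rewrite dact0.
  apply: (mop_span_ind (Q := fun F => dact F D = 0)).
    exact: left_linear0 (dact_left_linear D).
  move=> j c G IHG; rewrite dact_left_linear IHG addr0 DD.
  have [Su _] := SP j.
  have -> : symbol D j = 0.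
    rewrite -[symbol D j](mulKVmx Su) -[_ *m symbol D j](mulmxK Su).
    by rewrite -/(ev j D) ev0 mul0mx mulmx0.
  by rewrite scale0r scaler0.
apply: (@star_algebra_fingen C n.+1 _ eigenoperator ev dag gram archC) => //.
- exact: eigenoperator0.
- by move=> a D E [K DK] [L EL]; eexists; apply: eigenZD DK EL.
- by move=> D E [K DK] [L EL]; eexists; apply: eigenM DK EL.
- by move=> D /dagP; exists (adj_eigenvalue (symbol D)).
move=> k D E DD EE; rewrite -ev_dag //.
rewrite /gram -[_.[_]]/(horner_eval k%:R _) -trace_map_mx map_mxM /= !horner_symbol_mx.
have [Su _] := SP k; rewrite /ev !mulmxA mulmxK //.
by rewrite [RHS]mxtrace_mulC !mulmxA mulmxV // mul1mx.
Qed.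

End FixedMop.
End OrthogonalPolynomials.

(** * Integrals of complex functions *)

Section ComplexIntegral.
Local Open Scope complex_scope.
Local Open Scope classical_set_scope.
Context {R : realType}.
Local Notation C := R[i].
Local Notation mu := (@lebesgue_measure R).
Local Notation Re := (@complex.Re R).
Local Notation Im := (@complex.Im R).
Implicit Types f g : R -> C.

Lemma complex_archimedean (x : C) : exists n : nat, `|x| < n%:R.
Proof.
have xr : (Re `|x|)%:C = `|x| by rewrite RRe_real // normr_real.
exists (Num.bound (Re `|x|)); rewrite -[X in X < _]xr.
rewrite -(rmorph_nat (real_complex R)) ltcR archi_boundP //.
by rewrite -lecR xr normr_ge0.
Qed.

Lemma ReD (x y : C) : Re (x + y) = Re x + Re y. Proof. by case: x; case: y. Qed.
Lemma ImD (x y : C) : Im (x + y) = Im x + Im y. Proof. by case: x; case: y. Qed.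
Lemma ReM (x y : C) : Re (x * y) = Re x * Re y - Im x * Im y.
Proof. by case: x; case: y. Qed.
Lemma ImM (x y : C) : Im (x * y) = Re x * Im y + Im x * Re y.
Proof. by case: x; case: y. Qed.
Lemma Reconj (x : C) : Re (x^*)%R = Re x. Proof. by case: x. Qed.
Lemma Imconj (x : C) : Im (x^*)%R = - Im x. Proof. by case: x. Qed.

Lemma integrable_lin (a b : R) (f g : R -> R) :
  mu.-integrable setT (EFin \o f) -> mu.-integrable setT (EFin \o g) ->
  mu.-integrable setT (EFin \o (fun t => a * f t + b * g t)) /\
  Rintegral mu setT (fun t => a * f t + b * g t) =
    a * Rintegral mu setT f + b * Rintegral mu setT g.
Proof.
move=> intf intg.
have intaf : mu.-integrable setT (EFin \o (fun t => a * f t)).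
  have := integrableZl measurableT a intf.
  by congr integrable; apply/funext => t; rewrite /= EFinM.
have intbg : mu.-integrable setT (EFin \o (fun t => b * g t)).
  have := integrableZl measurableT b intg.
  by congr integrable; apply/funext => t; rewrite /= EFinM.
split.
  have := integrableD measurableT intaf intbg.
  by congr integrable; apply/funext => t; rewrite /= EFinD.
by rewrite RintegralD // !RintegralZl.
Qed.

Lemma cintegrableZD (c : C) f g : cintegrable f -> cintegrable g ->
  cintegrable (fun t => c * f t + g t) /\
  cintegral (fun t => c * f t + g t) = c * cintegral f + cintegral g.
Proof.
move=> [fr fi] [gr gi].
have [r1 r2] := integrable_lin (Re c) (- Im c) fr fi.
have [i1 i2] := integrable_lin (Re c) (Im c) fi fr.
have [r3 r4] := integrable_lin 1 1 r1 gr.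
have [i3 i4] := integrable_lin 1 1 i1 gi.
have eR : (fun t => Re (c * f t + g t)) =
    (fun t => 1 * (Re c * Re (f t) + - Im c * Im (f t)) + 1 * Re (g t)).
  by apply/funext => t; rewrite ReD ReM !mul1r mulNr.
have eI : (fun t => Im (c * f t + g t)) =
    (fun t => 1 * (Re c * Im (f t) + Im c * Re (f t)) + 1 * Im (g t)).
  by apply/funext => t; rewrite ImD ImM !mul1r.
split; first by split; [move: r3|move: i3]; congr integrable; apply/funext => t /=;
  [have := congr1 (@^~ t) eR|have := congr1 (@^~ t) eI] => /= ->.
rewrite /cintegral eR eI r4 i4 r2 i2 !mul1r; apply/eqP.
rewrite eq_complex ReD ImD ReM ImM /= mulNr eqxx /=.
by rewrite eqxx.
Qed.

Lemma cintegrable0 : cintegrable (fun=> 0 : C).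
Proof. by split; apply: integrable0. Qed.

Lemma cintegral0 : cintegral (fun=> 0 : C) = 0.
Proof. by rewrite /cintegral /= /Rintegral integral0. Qed.

Lemma cintegral_sum (I : Type) (r : seq I) (c : I -> C) (f : I -> R -> C) :
  (forall i, cintegrable (f i)) ->
  cintegrable (fun t => \sum_(i <- r) c i * f i t) /\
  cintegral (fun t => \sum_(i <- r) c i * f i t) =
    \sum_(i <- r) c i * cintegral (f i).
Proof.
move=> intf; elim: r => [|i r [IH1 IH2]].
  rewrite big_nil; have -> : (fun t => \sum_(i <- [::]) c i * f i t) = (fun=> 0).
    by apply/funext => t; rewrite big_nil.
  by split; [exact: cintegrable0|exact: cintegral0].
have [H1 H2] := cintegrableZD (c i) (intf i) IH1.
have e : (fun t => \sum_(j <- i :: r) c j * f j t) =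
   (fun t => c i * f i t + \sum_(j <- r) c j * f j t).
  by apply/funext => t; rewrite big_cons.
by rewrite e big_cons -IH2.
Qed.

Lemma cintegral_conj f : cintegrable f ->
  cintegral (fun t => (f t)^*)%R = ((cintegral f)^*)%R.
Proof.
move=> [fr fi]; rewrite /cintegral; apply/eqP; rewrite eq_complex Reconj Imconj /=.
under eq_Rintegral do rewrite Reconj.
rewrite eqxx /=; under eq_Rintegral do rewrite Imconj -mulN1r.
by rewrite RintegralZl // mulN1r.
Qed.

End ComplexIntegral.

(** * The inner product of a weight *)

Section WeightForm.
Local Open Scope complex_scope.
Local Open Scope classical_set_scope.
Context {R : realType} {n : nat}.
Local Notation C := R[i].
Local Notation Mx := 'M[C]_n.+1.
Variables (x0 x1 : \bar R) (W : R -> Mx).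
Hypothesis hW : weight_matrix x0 x1 W.
Implicit Types (F G : {poly Mx}).

Definition entry_poly F (i j : 'I_n.+1) : {poly C} := \poly_(a < size F) (F`_a i j).

Lemma evalmx_entry_poly F t i j : evalmx F t i j = (entry_poly F i j).[t%:C].
Proof.
rewrite /evalmx horner_coef horner_poly summxE; apply: eq_bigr => a _.
rewrite -(rmorphXn (@scalar_mx C n.+1)) /= -[_ * _]/(_ *m _).
by rewrite mul_mx_scalar mxE mulrC.
Qed.

Lemma cintegrable_poly_weight (p : {poly C}) i j :
  cintegrable (fun t => p.[t%:C] * W t i j).
Proof.
have [+ _] := @cintegral_sum R _ (index_enum 'I_(size p)) (fun a => p`_a)
  (fun a t => t%:C ^+ a * W t i j) (fun a => weight_moments hW a i j).
congr cintegrable; apply/funext => t; rewrite horner_coef mulr_suml.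
by apply: eq_bigr => a _; rewrite mulrA.
Qed.

Definition integrand F G t : Mx := evalmx F t *m W t *m (evalmx G t)^t*.

Lemma cintegrable_sum (I : Type) (r : seq I) (f : I -> R -> C) :
  (forall i, cintegrable (f i)) -> cintegrable (fun t => \sum_(i <- r) f i t).
Proof.
move=> intf; have [+ _] := @cintegral_sum R I r (fun=> 1) f intf.
by congr cintegrable; apply/funext => t; apply: eq_bigr => i _; rewrite mul1r.
Qed.

Lemma conj_horner_real (p : {poly C}) t :
  (p.[t%:C])^*%R = (map_poly Num.conj p).[t%:C].
Proof.
have tr : (t%:C)^*%R = t%:C by apply/CrealP/complex_realP; exists t.
by rewrite -{2}tr horner_map.
Qed.

Lemma cintegrable_integrand F G i j : cintegrable (fun t => integrand F G t i j).
Proof.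
have := @cintegrable_sum _ (index_enum 'I_n.+1) (fun k t => \sum_l
  (entry_poly F i l * map_poly Num.conj (entry_poly G j k)).[t%:C] * W t l k).
have h : forall k, cintegrable (fun t => \sum_l
  (entry_poly F i l * map_poly Num.conj (entry_poly G j k)).[t%:C] * W t l k).
  by move=> k; apply: cintegrable_sum => l; apply: cintegrable_poly_weight.
move=> /(_ h); congr cintegrable; apply/funext => t; rewrite mxE.
apply: eq_bigr => k _; rewrite mxE mulr_suml; apply: eq_bigr => l _.
by rewrite !mxE !evalmx_entry_poly hornerM conj_horner_real mulrAC.
Qed.

Lemma weight_innerE F G i j :
  weight_inner W F G i j = cintegral (fun t => integrand F G t i j).
Proof. by rewrite mxE. Qed.

Lemma weight_innerZD (c : Mx) F G K :
  weight_inner W (c *: F + G) K = c *m weight_inner W F K + weight_inner W G K.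
Proof.
apply/matrixP => i j; rewrite weight_innerE [RHS]mxE [(c *m _) i j]mxE.
have [H1 H2] := @cintegral_sum R _ (index_enum 'I_n.+1) (fun k => c i k)
  (fun k t => integrand F K t k j) (fun k => cintegrable_integrand F K k j).
have [_ H4] := cintegrableZD 1 H1 (cintegrable_integrand G K i j).
rewrite !mul1r H2 in H4.
transitivity (cintegral (fun t =>
  1 * \sum_k c i k * integrand F K t k j + integrand G K t i j)).
  congr cintegral; apply/funext => t; rewrite mul1r /integrand.
  have -> : evalmx (c *: F + G) t = c *m evalmx F t + evalmx G t.
    by rewrite /evalmx hornerD hornerZ.
  rewrite !mulmxDl mxE; congr (_ + _).
  by rewrite -!mulmxA mxE; apply: eq_bigr => k _; rewrite !mulmxA.
apply: (etrans H4); rewrite -(weight_innerE G K i j); congr (_ + _).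
by apply: eq_bigr => k _; rewrite (weight_innerE F K k j).
Qed.

Lemma weight_hermE t : (W t)^t* = W t.
Proof.
have := is_hermitianmxP _ _ _ (weight_herm hW t).
by rewrite expr0 scale1r => {2}->.
Qed.

Lemma weight_inner_herm F G : weight_inner W G F = (weight_inner W F G)^t*.
Proof.
apply/matrixP => i j; rewrite mxE [in RHS]mxE [in RHS]mxE mxE.
apply: etrans (cintegral_conj (cintegrable_integrand F G j i)).
congr cintegral; apply/funext => t.
have -> : evalmx G t *m W t *m (evalmx F t)^t* = (integrand F G t)^t*.
  by rewrite /integrand !trmx_mul !map_mxM trmxCK weight_hermE mulmxA.
by rewrite mxE [in LHS]mxE.
Qed.

Lemma evalmx_mulX F t : evalmx (F * 'X) t = t%:C *: evalmx F t.
Proof. by rewrite /evalmx hornerMX -mul_mx_scalar. Qed.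

Lemma adj_scale_real (t : R) (A : Mx) : (t%:C *: A)^t* = t%:C *: A^t*.
Proof.
apply/matrixP => i j; rewrite !mxE rmorphM; congr (_ * _).
by apply/CrealP/complex_realP; exists t.
Qed.

Lemma integrand_mulX F G t : integrand (F * 'X) G t = integrand F (G * 'X) t.
Proof.
rewrite /integrand (evalmx_mulX F t) (evalmx_mulX G t).
rewrite (adj_scale_real t (evalmx G t)).
have -> : t%:C *: evalmx F t *m W t = t%:C *: (evalmx F t *m W t).
  by rewrite scalemxAl.
set A := evalmx F t *m W t; set B := (evalmx G t)^t*.
have -> : t%:C *: A *m B = t%:C *: (A *m B) by rewrite scalemxAl.
by rewrite (scalemxAr (t%:C) A B).
Qed.

Lemma weight_inner_mulX F G :
  weight_inner W (F * 'X) G = weight_inner W F (G * 'X).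
Proof.
apply/matrixP => i j; apply: (etrans (weight_innerE (F * 'X) G i j)).
apply: etrans (esym (weight_innerE F (G * 'X) i j)).
have -> : integrand (F * 'X) G = integrand F (G * 'X).
  by apply/funext => t; rewrite integrand_mulX.
by [].
Qed.

End WeightForm.

(** * Definiteness of the inner product *)

Section RealPositivity.
Local Open Scope complex_scope.
Local Open Scope classical_set_scope.
Context {R : realType}.
Local Notation mu := (@lebesgue_measure R).

Lemma open_itv_sub (x0 x1 : \bar R) : (x0 < x1)%E ->
  exists a b : R, a < b /\ forall t, a <= t <= b -> open_itv x0 x1 t.
Proof.
case: x0 => [x| |]; case: x1 => [y| |] //=; rewrite ?lte_fin => lt_xy.
- exists (x + (y - x) / 3), (x + (y - x) / 2); split; first by lra.
  by move=> t ht; rewrite /open_itv /= !lte_fin; apply/andP; split; lra.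
- exists (x + 1), (x + 2); split; first by lra.
  by move=> t ht; rewrite /open_itv /= !lte_fin ltry andbT; lra.
- exists (y - 2), (y - 1); split; first by lra.
  by move=> t ht; rewrite /open_itv /= !lte_fin ltNyr /=; lra.
- exists 0, 1; split; first by lra.
  by move=> t ht; rewrite /open_itv /= ltNyr ltry.
Qed.

(** If the integral were zero, g would vanish almost everywhere, and [a, b] would
    be contained in the union of two negligible sets. *)
Lemma Rintegral_gt0 (g : R -> R) (a b : R) (S : set R) :
  mu.-integrable setT (EFin \o g) -> (forall t, 0 <= g t) -> a < b ->
  countable S -> (forall t, a <= t <= b -> ~ S t -> 0 < g t) ->
  0 < Rintegral mu setT g.
Proof.
move=> intg g0 ltab cS gpos.
rewrite lt_neqAle Rintegral_ge0 // andbT eq_sym; apply/eqP => /eqP int0.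
have /eqP : (\int[mu]_(x in setT) (EFin \o g) x)%E = 0%E.
  rewrite -[LHS]fineK; last exact: integrable_fin_num.
  by move: int0; rewrite /Rintegral => /eqP ->.
have -> : (\int[mu]_(x in setT) (EFin \o g) x)%E =
    (\int[mu]_(x in setT) `|(EFin \o g) x|)%E.
  by apply: eq_integral => t _; rewrite /= ger0_norm.
move=> /eqP/(ae_eq_integral_abs mu measurableT (measurable_int _ intg)) g_ae0.
have negS : mu.-negligible S.
  have mS : measurable S by exact: countable_measurable.
  by apply/negligibleP => //; apply: countable_lebesgue_measure0.
have : mu.-negligible `[a, b].
  apply: negligibleS (negligibleU g_ae0 negS) => t /=.
  rewrite in_itv /= => tab; have [St|nSt] := pselect (S t); first by right.
  left => /= /(_ I)[gt0]; have := gpos t tab nSt.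
  by rewrite gt0 ltxx.
move=> negab; have : mu `[a, b] = 0%E by apply/negligibleP.
rewrite lebesgue_measure_itv /= lte_fin ltab -EFinB => -[] /eqP.
by rewrite subr_eq0 gt_eqF.
Qed.

Lemma countable_real_roots (p : {poly R[i]}) : p != 0 ->
  countable [set t : R | p.[t%:C] = 0].
Proof.
move=> nzp; apply: finite_set_countable.
have [rs prs] := closed_field_poly_normal p.
apply: (@sub_finite_set _ _ [set` map (@complex.Re R) rs]); last exact: finite_seq.
move=> t /= pt0; apply/mapP; exists (t%:C) => //.
move: pt0; rewrite prs hornerZ => /eqP.
rewrite mulf_eq0 lead_coef_eq0 (negPf nzp) /=.
by rewrite -rootE root_prod_XsubC.
Qed.

End RealPositivity.

Section WeightPositivity.
Local Open Scope complex_scope.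
Local Open Scope classical_set_scope.
Context {R : realType} {n : nat}.
Local Notation C := R[i].
Local Notation Mx := 'M[C]_n.+1.
Variables (x0 x1 : \bar R) (W : R -> Mx).
Hypothesis hW : weight_matrix x0 x1 W.
Implicit Types F : {poly Mx}.

Definition quad (v : 'rV[C]_n.+1) (A : Mx) : C := (v *m A *m v^t*) 0 0.

Lemma quadE v A : quad v A = \sum_j (v 0 j)^*%R * \sum_i v 0 i * A i j.
Proof.
rewrite /quad mxE; apply: eq_bigr => j _.
by rewrite mulrC mxE [in X in X * _]mxE mxE.
Qed.

Lemma quad_weight_inner v F :
  cintegrable (fun t => quad v (integrand W F F t)) /\
  quad v (weight_inner W F F) = cintegral (fun t => quad v (integrand W F F t)).
Proof.
have inner j := @cintegral_sum R _ (index_enum 'I_n.+1) (fun i => v 0 i)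
  (fun i t => integrand W F F t i j) (fun i => cintegrable_integrand hW F F i j).
have [outer1 outer2] := @cintegral_sum R _ (index_enum 'I_n.+1)
  (fun j => (v 0 j)^*%R) (fun j t => \sum_i v 0 i * integrand W F F t i j)
  (fun j => (inner j).1).
have -> : (fun t => quad v (integrand W F F t)) =
    (fun t => \sum_j (v 0 j)^*%R * \sum_i v 0 i * integrand W F F t i j).
  by apply/funext => t; rewrite quadE.
split => //; rewrite quadE outer2; apply: eq_bigr => j _; congr (_ * _).
rewrite (inner j).2; apply: eq_bigr => i _; congr (_ * _).
by rewrite weight_innerE.
Qed.

Lemma quad_integrand v F t :
  quad v (integrand W F F t) = quad (v *m evalmx F t) (W t).
Proof. by rewrite /quad /integrand trmx_mul map_mxM !mulmxA. Qed.

Lemma quad_weight_gt0 u t : open_itv x0 x1 t -> u != 0 -> 0 < quad u (W t).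
Proof. by move=> xt nzu; apply: (weight_posdef hW xt). Qed.

Lemma quad_weight_ge0 u t : 0 <= quad u (W t).
Proof.
have [->|nzu] := eqVneq u 0; first by rewrite /quad !mul0mx mxE.
have [xt|nxt] := pselect (open_itv x0 x1 t).
  by apply: ltW; apply: quad_weight_gt0.
by rewrite /quad (weight_supp hW nxt) mulmx0 mul0mx mxE.
Qed.

(** For F monic and v 0 j nonzero, the entry j of v F(t) is a nonzero polynomial in
    t, so the integrand of v <F, F> v^* is positive on the interval away from
    finitely many points. *)
Lemma weight_inner_gt0 F (v : 'rV[C]_n.+1) : F \is monic -> v != 0 ->
  0 < (v *m weight_inner W F F *m v^t*) 0 0.
Proof.
move=> mF nzv; rewrite -/(quad v (weight_inner W F F)).
have [[intRe intIm] ->] := quad_weight_inner v F.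
set f := fun t => quad v (integrand W F F t).
have f_ge0 t : 0 <= f t by rewrite /f quad_integrand quad_weight_ge0.
have [j nzvj] : exists j, v 0 j != 0.
  by case/rV0Pn: nzv => j vj; exists j.
pose p : {poly C} := \sum_i v 0 i *: entry_poly F i j.
have pE t : p.[t%:C] = (v *m evalmx F t) 0 j.
  rewrite horner_sum mxE; apply: eq_bigr => i _.
  by rewrite hornerZ evalmx_entry_poly.
have nzp : p != 0.
  apply/eqP => p0; case/eqP: nzvj.
  have := congr1 (fun q : {poly C} => q`_(size F).-1) p0.
  rewrite coef0 coef_sum (bigD1 j) //= big1 => [|i ij]; rewrite coefZ coef_poly.
    rewrite prednK ?size_poly_gt0 ?monic_neq0 // leqnn.
    by have := monicP mF; rewrite /lead_coef => ->; rewrite mxE eqxx mulr1 addr0.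
  rewrite prednK ?size_poly_gt0 ?monic_neq0 // leqnn.
  by have := monicP mF; rewrite /lead_coef => ->; rewrite mxE (negPf ij) mulr0.
have [a [b [ltab abx]]] := open_itv_sub (weight_itv hW).
rewrite ltcE /=; apply/andP; split.
  have -> : (fun t => complex.Im (f t)) = (fun=> 0).
    by apply/funext => t; apply: ger0_Im.
  by rewrite /Rintegral integral0.
apply: (@Rintegral_gt0 R _ a b _ intRe _ ltab (countable_real_roots nzp)).
  by move=> t; have := f_ge0 t; rewrite lecE => /andP[].
move=> t tab /= pt0.
suff : 0 < f t by rewrite ltcE => /andP[].
rewrite /f quad_integrand; apply: quad_weight_gt0; first exact: abx.
by apply/eqP => vF0; apply: pt0; rewrite pE vF0 mxE.
Qed.

End WeightPositivity.

(** * Finite generation of D(W) *)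

Lemma mop_monic_orthogonal (R : realType) (n : nat) (W : R -> 'M[R[i]]_n.+1) P :
  monic_orthogonal W P <-> mop (weight_inner W) P.
Proof. by split; [case|case=> *; split]. Qed.

Theorem theorem4p12 (R : realType) (n : nat) (x0 x1 : \bar R)
    (W : R -> 'M[complex R]_n.+1) (hW : weight_matrix x0 x1 W) :
  affine_subalgebra (DW W).
Proof.
have ipZD := weight_innerZD hW.
have ip_herm := weight_inner_herm hW.
have ip_mulX := weight_inner_mulX W.
have ip_gt0 := weight_inner_gt0 hW.
have [P mopP] := exists_mop ipZD ip_herm ip_gt0.
have DWE : DW W = [set D | eigenoperator P D]%classic.
  apply/seteqP; split=> D.
    move=> [P' /mop_monic_orthogonal mopP' [L DL]].
    by exists L => k; rewrite -(mop_uniq ipZD ip_herm ip_gt0 mopP mopP').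
  by move=> [L DL]; exists P; [apply/mop_monic_orthogonal|exists L].
have [s [sP genP]] :=
  eigenoperator_fingen ipZD ip_herm ip_gt0 mopP ip_mulX (@complex_archimedean R).
exists s; rewrite DWE; apply/seteqP; split=> [D DD S [Salg sS]|].
  by apply: (genP (fun x => S x) Salg) DD => E; apply: sS.
apply: smallest_sub; last by move=> D; apply: sP.
split=> [|a D E|D E]; rewrite !inE.
- exact: eigenoperator1.
- by move=> [K DK] [L EL]; eexists; apply: eigenZD DK EL.
- by move=> [K DK] [L EL]; eexists; apply: eigenM DK EL.
Qed.
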